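(* Let $d=2$. Suppose that for every internal edge $e_{ij}$ of the simplicial (triangular) mesh $\mathcal{T}_h$ of $\Omega\subset\mathbb{R}^2$, connecting an interior vertex $\boldsymbol{a}_i$ ($1\le i\le N_{vi}$) with a vertex $\boldsymbol{a}_j$ ($1\le j\le N_v$, $j\ne i$) and shared by the two elements $K$ and $K'$, one has $$0<\frac12\Bigg[\alpha_{ij,\mathbb{D}_K^{-1}}+\alpha_{ij,\mathbb{D}_{K'}^{-1}}+\operatorname{arccot}\!\left(\sqrt{\frac{\det(\mathbb{D}_{K'})}{\det(\mathbb{D}_K)}}\cot(\alpha_{ij,\mathbb{D}_{K'}^{-1}})-\frac{2\,C(K,K',j)}{\sqrt{\det(\mathbb{D}_K)}}\right)+\operatorname{arccot}\!\left(\sqrt{\frac{\det(\mathbb{D}_K)}{\det(\mathbb{D}_{K'})}}\cot(\alpha_{ij,\mathbb{D}_K^{-1}})-\frac{2\,C(K,K',j)}{\sqrt{\det(\mathbb{D}_{K'})}}\right)\Bigg]\le\pi,$$ where $$C(K,K',j)=\frac{|K|\,\|\boldsymbol{b}\|_{\infty,K}}{h_j^K(d+1)}+\frac{|K|\,\|c\|_{\infty,K}}{(d+1)(d+2)}+\frac{|K'|\,\|\boldsymbol{b}\|_{\infty,K'}}{h_j^{K'}(d+1)}+\frac{|K'|\,\|c\|_{\infty,K'}}{(d+1)(d+2)},\qquad d=2.$$ Then the linear finite element scheme on $\mathcal{T}_h$ for the two-dimensional boundary value problem $$-\nabla\cdot(\mathbb{D}\nabla u)+\boldsymbol{b}\cdot\nabla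 u+c\,u=f\ \text{ in }\Omega,\qquad u=g\ \text{ on }\partial\Omega,$$ satisfies the discrete maximum principle.
   Context: **Problem.** $\Omega\subset\mathbb{R}^2$ is a connected (bounded) polygonal domain. $\mathbb{D}=\mathbb{D}(\boldsymbol{x})\in\mathbb{R}^{2\times2}$, $\boldsymbol{b}=\boldsymbol{b}(\boldsymbol{x})\in\mathbb{R}^2$, and the scalar functions $c,f,g$ are given and sufficiently smooth (up to the boundary). For every $\boldsymbol{x}$ the matrix $\mathbb{D}(\boldsymbol{x})$ is symmetric and strictly positive definite, and $c(\boldsymbol{x})-\frac12\nabla\cdot\boldsymbol{b}(\boldsymbol{x})\ge0$ and $c(\boldsymbol{x})\ge0$ for all $\boldsymbol{x}\in\Omega$. **Mesh and scheme.** $\mathcal{T}_h$ is a (conforming) triangular mesh of $\Omega$ with vertices $\boldsymbol{a}_1,\dots,\boldsymbol{a}_{N_v}$, of which the first $N_{vi}$ are the interior vertices (those not on $\partial\Omega$). $\phi_j$ is the continuous piecewise linear nodal basis function with $\phi_j(\boldsymbol{a}_k)=\delta_{jk}$, and $U_0^h=\mathrm{span}\{\phi_1,\dots,\phi_{N_{vi}}\}$. The linear finite element scheme is: find $u^h=\sum_{j=1}^{N_v}u_j\phi_j$ with $u_j=g(\boldsymbol{a}_j)$ for $j=N_{vi}+1,\dots,N_v$ such that for all $v^h\in U_0^h$, $$\sum_{K\in\mathcal{T}_h}|K|(\nabla v^h)^T\mathbb{D}_K\nabla u^h+\sum_{K\in\mathcal{T}_h}\int_K v^h(\boldsymbol{b}\cdot\nabla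 u^h)\,d\boldsymbol{x}+\sum_{K\in\mathcal{T}_h}\int_K c\,u^hv^h\,d\boldsymbol{x}=\sum_{K\in\mathcal{T}_h}\int_K f\,v^h\,d\boldsymbol{x},$$ where $|K|$ is the area of $K$ and $\mathbb{D}_K=\frac1{|K|}\int_K\mathbb{D}\,d\boldsymbol{x}$. **Element quantities.** For an element $K$ containing the edge $e_{ij}$, $h_j^K$ is the Euclidean distance from $\boldsymbol{a}_j$ to (the line of) the edge of $K$ opposite to $\boldsymbol{a}_j$. $\alpha_{ij,\mathbb{D}_K^{-1}}\in(0,\pi)$ is the angle of $K$ facing (opposite to) the edge $e_{ij}$, measured in the metric $\mathbb{D}_K^{-1}$, i.e. the corresponding Euclidean angle of the triangle $\mathbb{D}_K^{-1/2}K$; equivalently, with $\boldsymbol{q}_i=\nabla\phi_i|_K$ and $\boldsymbol{q}_j=\nabla\phi_j|_K$, $$\cos(\alpha_{ij,\mathbb{D}_K^{-1}})=-\frac{\boldsymbol{q}_i^T\mathbb{D}_K\boldsymbol{q}_j}{\sqrt{\boldsymbol{q}_i^T\mathbb{D}_K\boldsymbol{q}_i}\,\sqrt{\boldsymbol{q}_j^T\mathbb{D}_K\boldsymbol{q}_j}}.$$ The same definitions apply to $K'$. $\|\boldsymbol{b}\|_{\infty,K}=\max_{\boldsymbol{x}\in K}\|\boldsymbol{b}(\boldsymbol{x})\|$ with $\|\cdot\|$ the Euclidean norm; $\|c\|_{\infty,K}=\max_{\boldsymbol{x}\in K}c(\boldsymbol{x})$. The function $\operatorname{arccot}$ takes values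 in $(0,\pi)$. Since $C(K,K',j)$ depends on which endpoint is called $\boldsymbol{a}_j$, the condition is required for every admissible pair $(i,j)$; for an edge joining two interior vertices this means for both orderings. **Discrete maximum principle (DMP).** The scheme satisfies DMP if, for its solution $u^h$, $f\le0$ in $\Omega$ implies $\max_{\boldsymbol{x}\in\overline\Omega}u^h(\boldsymbol{x})\le\max\{0,\max_{\boldsymbol{x}\in\partial\Omega}u^h(\boldsymbol{x})\}$. *)

(* Defs.v *)
From mathcomp Require Import all_boot all_order all_algebra.
From mathcomp Require Import all_classical all_reals all_analysis.

Set Implicit Arguments.
Unset Strict Implicit.
Unset Printing Implicit Defensive.

Import Order.TTheory GRing.Theory Num.Theory.
Import numFieldNormedType.Exports.

Local Open Scope classical_set_scope.
Local Open Scope ring_scope.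

(* The plane is R * R, which carries both the product topology and the product
   Lebesgue measure; vectors that meet matrices are columns 'cV[R]_2. *)

Section Plane.
Variable R : realType.

Definition vec (x : R * R) : 'cV[R]_2 := \col_i (if i == 0 then x.1 else x.2).

Definition dot (u v : 'cV[R]_2) : R := (u^T *m v) 0 0.

Definition enorm (u : 'cV[R]_2) : R := Num.sqrt (dot u u).

Definition eucl_dist (x y : R * R) : R := enorm (vec (x - y)).

Definition lebesgue2 : set (R * R) -> \bar R :=
  ((@lebesgue_measure R) \x (@lebesgue_measure R))%E.

Definition area (K : set (R * R)) : R := fine (lebesgue2 K).

Definition integral2 (K : set (R * R)) (f : R * R -> R) : R :=
  Rintegral ((@lebesgue_measure R) \x (@lebesgue_measure R))%E K f.

Definition boundary (A : set (R * R)) : set (R * R) := closure A `\` interior A.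

Definition segment (p q : R * R) : set (R * R) :=
  [set x | exists2 t : R, 0 <= t <= 1 & x = (1 - t) *: p + t *: q].

Definition polygonal_domain (Omega : set (R * R)) : Prop :=
  [/\ open Omega, connected Omega, Omega !=set0, bounded_set Omega &
      exists s : seq ((R * R) * (R * R)),
        boundary Omega = [set x | exists2 e, e \in s & segment e.1 e.2 x]].

Definition continuous_upto_boundary (Omega : set (R * R)) (v : R * R -> R) :=
  {within closure Omega, continuous v}.

Definition C1_upto_boundary (Omega : set (R * R)) (v : R * R -> R) : Prop :=
  [/\ continuous_upto_boundary Omega v,
      forall x, Omega x -> differentiable v x &
      forall e, e = (1, 0) \/ e = (0, 1) ->
        exists2 w, continuous_upto_boundary Omega w &
                   forall x, Omega x -> w x = 'D_e v x].

Definition divergence (b : R * R -> 'cV[R]_2) (x : R * R) : R :=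
  'D_((1, 0) : R * R) (fun y => b y 0 0) x +
  'D_((0, 1) : R * R) (fun y => b y 1 0) x.

Definition sym_posdef (A : 'M[R]_2) : Prop :=
  A^T = A /\ forall v : 'cV[R]_2, v != 0 -> 0 < dot v (A *m v).

Record bvp_data (Omega : set (R * R)) (D : R * R -> 'M[R]_2)
    (b : R * R -> 'cV[R]_2) (c f g : R * R -> R) : Prop := BvpData {
  bvp_domain : polygonal_domain Omega;
  bvp_D_smooth : forall i j, C1_upto_boundary Omega (fun x => D x i j);
  bvp_b_smooth : forall i, C1_upto_boundary Omega (fun x => b x i 0);
  bvp_c_smooth : continuous_upto_boundary Omega c;
  bvp_f_smooth : continuous_upto_boundary Omega f;
  bvp_g_smooth : {within boundary Omega, continuous g};
  bvp_D_posdef : forall x, Omega x -> sym_posdef (D x);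
  bvp_cb_ge0 : forall x, Omega x -> 0 <= c x - 2^-1 * divergence b x;
  bvp_c_ge0 : forall x, Omega x -> 0 <= c x }.

(* S is a set of vertex indices; the affine (resp. convex) hull of the
   corresponding vertices is the set of their affine (resp. convex)
   combinations. *)
Definition aff_hull n (a : 'I_n -> R * R) (S : {set 'I_n}) : set (R * R) :=
  [set x | exists2 w : 'I_n -> R,
     \sum_(i in S) w i = 1 & x = \sum_(i in S) w i *: a i].

Definition conv_hull n (a : 'I_n -> R * R) (S : {set 'I_n}) : set (R * R) :=
  [set x | exists w : 'I_n -> R,
     [/\ forall i, i \in S -> 0 <= w i,
         \sum_(i in S) w i = 1 & x = \sum_(i in S) w i *: a i]].

(* A mesh element K is the set of indices of its three vertices; the closed
   triangle itself is conv_hull a K. *)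
Record conforming_mesh (Omega : set (R * R)) (Nvi Nv : nat)
    (a : 'I_Nv -> R * R) (T : {set {set 'I_Nv}}) : Prop := ConformingMesh {
  mesh_card : forall K, K \in T -> #|K| = 3%N;
  mesh_nondegenerate : forall K, K \in T -> interior (conv_hull a K) !=set0;
  mesh_cover : closure Omega = \bigcup_(K in [set K | K \in T]) conv_hull a K;
  mesh_inside : forall K, K \in T -> interior (conv_hull a K) `<=` Omega;
  mesh_conforming : forall K K', K \in T -> K' \in T ->
    conv_hull a K `&` conv_hull a K' = conv_hull a (K :&: K')%SET;
  mesh_vertex_inj : injective a;
  mesh_vertex_used : forall j, exists2 K, K \in T & j \in K;
  mesh_Nvi_le : (Nvi <= Nv)%N;
  mesh_interior_first : forall j : 'I_Nv,
    (j < Nvi)%N <-> ~ boundary Omega (a j) }.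

Definition has_gradient_on (K : set (R * R)) (v : R * R -> R) (q : 'cV[R]_2) :=
  exists m : R, forall x, K x -> v x = dot q (vec x) + m.

(* The constant gradient on K of a function that is affine on K. *)
Definition grad_on (K : set (R * R)) (v : R * R -> R) : 'cV[R]_2 :=
  get [set q | has_gradient_on K v q].

Definition nodal_basis (Omega : set (R * R)) (Nv : nat) (a : 'I_Nv -> R * R)
    (T : {set {set 'I_Nv}}) (phi : 'I_Nv -> R * R -> R) : Prop :=
  forall j, [/\ continuous_upto_boundary Omega (phi j),
    forall K, K \in T -> exists q, has_gradient_on (conv_hull a K) (phi j) q &
    forall k, phi j (a k) = (j == k)%:R].

Definition U0h (Nvi Nv : nat) (phi : 'I_Nv -> R * R -> R) : set (R * R -> R) :=
  [set v | exists w : 'I_Nv -> R,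
     v = fun x => \sum_(j : 'I_Nv | (j < Nvi)%N) w j * phi j x].

Definition avg_mx (K : set (R * R)) (D : R * R -> 'M[R]_2) : 'M[R]_2 :=
  \matrix_(i, j) ((area K)^-1 * integral2 K (fun x => D x i j)).

Definition fe_solution (Nvi Nv : nat) (a : 'I_Nv -> R * R)
    (T : {set {set 'I_Nv}}) (phi : 'I_Nv -> R * R -> R)
    (D : R * R -> 'M[R]_2) (b : R * R -> 'cV[R]_2) (c f g : R * R -> R)
    (uh : R * R -> R) : Prop :=
  exists u : 'I_Nv -> R,
  [/\ uh = (fun x => \sum_j u j * phi j x),
      forall j : 'I_Nv, (Nvi <= j)%N -> u j = g (a j) &
      forall v, U0h Nvi phi v ->
        \sum_(K in T) area (conv_hull a K) *
          dot (grad_on (conv_hull a K) v)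
              (avg_mx (conv_hull a K) D *m grad_on (conv_hull a K) uh)
      + \sum_(K in T) integral2 (conv_hull a K)
          (fun x => v x * dot (b x) (grad_on (conv_hull a K) uh))
      + \sum_(K in T) integral2 (conv_hull a K) (fun x => c x * uh x * v x)
      = \sum_(K in T) integral2 (conv_hull a K) (fun x => f x * v x)].

(* The suprema are maxima: uh is continuous on the compact set closure Omega. *)
Definition satisfies_DMP (Omega : set (R * R)) (Nvi Nv : nat)
    (a : 'I_Nv -> R * R) (T : {set {set 'I_Nv}}) (phi : 'I_Nv -> R * R -> R)
    (D : R * R -> 'M[R]_2) (b : R * R -> 'cV[R]_2) (c f g : R * R -> R) :
    Prop :=
  forall uh, fe_solution Nvi a T phi D b c f g uh ->
    (forall x, Omega x -> f x <= 0) ->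
    sup [set uh x | x in closure Omega]
      <= Num.max 0 (sup [set uh x | x in boundary Omega]).

(* The angle at the vertex r of the triangle p q r for the inner product
   u^T M v; for M = D^-1 it is the Euclidean angle of the triangle's image
   under D^(-1/2). *)
Definition metric_angle (M : 'M[R]_2) (r p q : R * R) : R :=
  let u := vec (p - r) in let v := vec (q - r) in
  acos (dot u (M *m v)
        / (Num.sqrt (dot u (M *m u)) * Num.sqrt (dot v (M *m v)))).

Definition height n (a : 'I_n -> R * R) (K : {set 'I_n}) (j : 'I_n) : R :=
  inf [set eucl_dist (a j) y | y in aff_hull a (K :\ j)%SET].

Definition cot (x : R) : R := cos x / sin x.

Definition arccot (x : R) : R := pi / 2 - atan x.

Definition C_elem (d : nat) n (a : 'I_n -> R * R) (b : R * R -> 'cV[R]_2)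
    (c : R * R -> R) (K : {set 'I_n}) (j : 'I_n) : R :=
  area (conv_hull a K) * sup [set enorm (b x) | x in conv_hull a K]
    / (height a K j * d.+1%:R)
  + area (conv_hull a K) * sup [set c x | x in conv_hull a K]
    / (d.+1%:R * d.+2%:R).

Definition C_pair n (a : 'I_n -> R * R) (b : R * R -> 'cV[R]_2)
    (c : R * R -> R) (K K' : {set 'I_n}) (j : 'I_n) : R :=
  C_elem 2 a b c K j + C_elem 2 a b c K' j.

(* k and k' are the vertices facing the edge i j in the two elements that share
   it. *)
Definition delaunay_type_condition (Nvi Nv : nat) (a : 'I_Nv -> R * R)
    (T : {set {set 'I_Nv}}) (D : R * R -> 'M[R]_2) (b : R * R -> 'cV[R]_2)
    (c : R * R -> R) : Prop :=
  forall (i j k k' : 'I_Nv) (K K' : {set 'I_Nv}),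
    (i < Nvi)%N -> j != i ->
    K \in T -> K' \in T -> K != K' ->
    K = [set i; j; k]%SET -> K' = [set i; j; k']%SET ->
    let DK := avg_mx (conv_hull a K) D in
    let DK' := avg_mx (conv_hull a K') D in
    let alpha := metric_angle (invmx DK) (a k) (a i) (a j) in
    let alpha' := metric_angle (invmx DK') (a k') (a i) (a j) in
    let C := C_pair a b c K K' j in
    0 < 2^-1 * (alpha + alpha'
          + arccot (Num.sqrt (\det DK' / \det DK) * cot alpha'
                    - 2 * C / Num.sqrt (\det DK))
          + arccot (Num.sqrt (\det DK / \det DK') * cot alpha
                    - 2 * C / Num.sqrt (\det DK')))
      <= pi.

End Plane.

(* Main.v *)
Require Import Defs.
From HB Require Import structures.
From mathcomp Require Import all_boot all_order all_algebra.
From mathcomp Require Import all_classical all_reals all_analysis.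
From mathcomp Require Import measurable_realfun.
From mathcomp Require Import ring lra.

(** The matrix of the scheme has nonpositive off-diagonal entries in the rows of
    interior vertices and nonnegative row sums; the maximum principle follows from
    an analysis of the case where these inequalities are equalities.

    Sign of the entries. For an edge from an interior vertex i to j, two elements K
    and K' contribute, one on each side of the edge ([opposite_element],
    [same_side_eq]). On each of them the diffusion term equals
    - sqrt (det D_K) * cot alpha_K / 2, where alpha_K is the angle that faces the
    edge in the metric of the inverse of D_K ([stiffness_cot]). The convection and
    reaction terms are at most C_elem, because the integrals of phi_i and
    phi_i * phi_j over K are |K| / 3 and |K| / 12 and the norm of the gradient of
    phi_j is the inverse of the height; the difference is the [slack]. Since
    arccot is decreasing, the angle condition means that
    sqrt (det D_K) * cot alpha_K + sqrt (det D_K') * cot alpha_K' is at least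
    2 * C ([angle_condition]). Hence the entry (i, j) is at most minus the two
    slacks ([edge_stiffness_le]). The row sums are integrals of c * phi_i.

    Equality. Suppose that the maximum of the nodal values is positive and exceeds
    the values on the boundary, and let S be the set of vertices where it is
    attained. All of them are interior. In the row of i in S the equation forces
    the integral of c * phi_i and the entries (i, j) with j outside S to vanish,
    and with them the slacks. A vanishing slack is an equality in Cauchy-Schwarz:
    on an element with vertices i in S and j outside S, the field b is a
    nonnegative multiple of the gradient of phi_j. If b did not vanish at a_j, the
    elements around a_j that meet S would form a fan inside a half-plane that
    never closes ([level_field_eq0]). So b vanishes on all these elements, c * phi_i
    does too, and only diffusion remains. The sum of the entries (i, j) over i in S
    and j outside S is then minus the diffusion energy of the sum of the phi_i over
    S. This energy is zero, hence no element has vertices both in S and outside S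
    ([level_neighbor_closed]). But an element around a rightmost vertex of S has a
    vertex further to the right ([level_empty]), a contradiction.

    The areas and integrals above are taken for the product Lebesgue measure; they
    come from the change of variables by affine maps ([rescales_affine_map]) and
    from iterated integrals over the reference triangle. *)

Set Implicit Arguments.
Unset Strict Implicit.
Unset Printing Implicit Defensive.

Import Order.TTheory GRing.Theory Num.Theory.
Import numFieldNormedType.Exports.

Local Open Scope classical_set_scope.
Local Open Scope ring_scope.

(** * Affine changes of variables for the plane Lebesgue measure *)

Section PlaneMeasure.
Variable R : realType.

Notation lam := (@lebesgue_measure R).
Notation line := (measurableTypeR R).

(** Lebesgue measure is determined by its values on half-open intervals, and the
    preimage of such an interval is again one, closed at the other end when s is
    negative. *)
Lemma lebesgue_measure_affine (s h : R) (A : set line) : s != 0 ->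
  measurable A -> lam A = (`|s|%:E * lam ((fun x => (s * x + h)%R) @^-1` A))%E.
Proof.
move=> s0 mA.
pose F (x : line) : line := s * x + h.
have mF : measurable_fun setT F.
  by apply: measurable_funD => //; exact: measurable_funM.
pose mF' := isMeasurableFun.Build _ _ _ _ F mF.
pose FF : {mfun _ >-> _} := HB.pack F mF'.
have -> : (`|s|%:E * lam (F @^-1` A))%E =
  mscale (`|s|%:nng) (pushforward lam FF) A by [].
apply: lebesgue_measure_unique => // _ [[a b] ab <-].
change (lam `]a, b] = (`|s|%:E * lam (F @^-1` `]a, b]%classic))%E).
have [s_gt0|s_lt0|sE] := ltgtP 0 s; last by rewrite -sE eqxx in s0.
- have -> : F @^-1` `]a, b]%classic = `](a - h) / s, (b - h) / s]%classic.
    apply/seteqP; split=> x /=; rewrite !in_itv /= /F ltr_pdivrMr// ler_pdivlMr//;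
      by rewrite (mulrC x) ltrBlDr lerBrDr.
  rewrite !lebesgue_measure_itv /= !lte_fin (gtr0_norm s_gt0).
  rewrite ltr_pM2r ?invr_gt0// ltrD2r.
  case: ifPn => _; last by rewrite mule0.
  by rewrite -!EFinD -EFinM; congr EFin; field.
- have -> : F @^-1` `]a, b]%classic = `[(b - h) / s, (a - h) / s[%classic.
    apply/seteqP; split=> x /=; rewrite !in_itv /= /F ltr_ndivlMr// ler_ndivrMr//;
      by rewrite (mulrC x) ltrBlDr lerBrDr andbC.
  rewrite !lebesgue_measure_itv /= !lte_fin (ltr0_norm s_lt0).
  rewrite ltr_nM2r ?invr_lt0// ltrD2r.
  case: ifPn => _; last by rewrite mule0.
  by rewrite -!EFinD -EFinM; congr EFin; field.
Qed.

(** Uniqueness of the product measure allows the slices to be taken along the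
    first axis as well; maps that act on the first coordinate need this form. *)
Lemma lebesgue2_yE (X : set (line * line)) : measurable X ->
  lebesgue2 X = (\int[lam]_y lam (ysection X y))%E.
Proof.
move=> mX.
have h A B : measurable A -> measurable B -> (lam \x^ lam)%E (A `*` B) = (lam A * lam B)%E.
  exact: (@product_measure2E _ _ line line R lam lam).
exact: (@product_measure_unique _ _ line line R lam lam (lam \x^ lam)%E h X mX).
Qed.

Lemma lebesgue2_xE (X : set (line * line)) :
  lebesgue2 X = (\int[lam]_x lam (xsection X x))%E.
Proof. by []. Qed.

(** Change of variables on preimages, so that neither images nor inverse maps
    have to be measurable; for an affine bijection k is the absolute value of
    the determinant. *)
Definition rescales (F : line * line -> line * line) (k : R) :=
  measurable_fun setT F /\
  forall X : set (line * line), measurable X ->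
    lebesgue2 X = (k%:E * lebesgue2 (F @^-1` X))%E.

Lemma rescales_comp F G k l : rescales F k -> rescales G l ->
  rescales (F \o G) (k * l).
Proof.
move=> [mF hF] [mG hG]; split; first exact: measurableT_comp.
move=> X mX; have mFX : measurable (F @^-1` X) by rewrite -[F @^-1` X]setTI; exact: mF.
by rewrite (hF X mX) (hG _ mFX) muleA EFinM.
Qed.

(** On every horizontal line the map is affine in one variable with the same
    slope s, whatever the shear h. *)
Lemma rescales_x (s : R) (h : line -> line) : s != 0 -> measurable_fun setT h ->
  rescales (fun z => (s * z.1 + h z.2, z.2)) `|s|.
Proof.
move=> s0 mh; set F := fun _ => _.
have mF : measurable_fun setT F.
  apply: measurable_fun_pair; last exact: measurable_snd.
  apply: measurable_funD; first by apply: measurable_funM => //; exact: measurable_fst.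
  by apply: measurableT_comp => //; exact: measurable_snd.
split=> // X mX.
have mFX : measurable (F @^-1` X) by rewrite -[_ @^-1` X]setTI; exact: mF.
rewrite !lebesgue2_yE// -ge0_integralZl//; last exact: measurable_fun_ysection.
apply: eq_integral => y _; have mXy : measurable (ysection X y) by exact: measurable_ysection.
rewrite (lebesgue_measure_affine (h y) s0 mXy).
by congr (_ * lam _)%E; apply/seteqP; split => x /=; rewrite /ysection /= !inE.
Qed.

Lemma rescales_y (s : R) (h : line -> line) : s != 0 -> measurable_fun setT h ->
  rescales (fun z => (z.1, s * z.2 + h z.1)) `|s|.
Proof.
move=> s0 mh; set F := fun _ => _.
have mF : measurable_fun setT F.
  apply: measurable_fun_pair; first exact: measurable_fst.
  apply: measurable_funD; first by apply: measurable_funM => //; exact: measurable_snd.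
  by apply: measurableT_comp => //; exact: measurable_fst.
split=> // X mX.
have mFX : measurable (F @^-1` X) by rewrite -[_ @^-1` X]setTI; exact: mF.
rewrite !lebesgue2_xE// -ge0_integralZl//; last exact: measurable_fun_xsection.
apply: eq_integral => y _ /=; have mXy : measurable (xsection X y) by exact: measurable_xsection.
rewrite (lebesgue_measure_affine (h y) s0 mXy).
by congr (_ * lam _)%E; apply/seteqP; split => x /=; rewrite /xsection /= !inE.
Qed.

(** The determinant of u and v, that is twice the signed area of the triangle
    with these edge vectors. *)
Definition cross (u v : R * R) : R := u.1 * v.2 - u.2 * v.1.

Definition affine_map (o u v z : R * R) : R * R := o + z.1 *: u + z.2 *: v.

Lemma affine_mapE o u v z : affine_map o u v z =
  (o.1 + z.1 * u.1 + z.2 * v.1, o.2 + z.1 * u.2 + z.2 * v.2).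
Proof. by []. Qed.

(** With a pivot u.1 <> 0 the map is a change of the first coordinate followed
    by a change of the second, with factors u.1 and cross u v / u.1. *)
Lemma rescales_affine_map (o u v : R * R) : cross u v != 0 ->
  rescales (affine_map o u v) `|cross u v|.
Proof.
have main (w : R * R) : w.1 != 0 -> cross w v != 0 ->
    rescales (affine_map o w v) `|cross w v|.
  move=> w0 e0.
  pose F (z : line * line) : line * line := (w.1 * z.1 + (v.1 * z.2 + o.1), z.2).
  pose G (z : line * line) : line * line :=
    (z.1, cross w v / w.1 * z.2 + (w.2 / w.1 * (z.1 - o.1) + o.2)).
  have -> : affine_map o w v = G \o F.
    apply/funext => z; rewrite affine_mapE /G /F /= /cross; congr pair; first by ring.
    by field.
  have -> : `|cross w v| = `|cross w v / w.1| * `|w.1|.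
    by rewrite -normrM divfK.
  apply: rescales_comp.
    apply: (@rescales_y _ (fun x => w.2 / w.1 * (x - o.1) + o.2)).
      by rewrite mulf_neq0// invr_neq0.
    by apply: measurable_funD => //; apply: measurable_funM => //; apply: measurable_funB.
  apply: (@rescales_x _ (fun y => v.1 * y + o.1)) => //.
  by apply: measurable_funD => //; apply: measurable_funM => //.
move=> e0; have [u0|] := eqVneq u.1 0; last by move=> /main; exact.
(* Without a pivot, replace u by u + v: a shear of the parameter plane, which
   keeps the determinant. *)
have v0 : v.1 != 0.
  by apply: contra_neq e0 => v0; rewrite /cross u0 v0; ring.
have crossD : cross (u + v) v = cross u v by rewrite /cross /=; ring.
have [mF hF] : rescales (affine_map o (u + v) v) `|cross u v|.
  by rewrite -crossD; apply: main; rewrite ?crossD//= u0 add0r.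
have [mS hS] := @rescales_y 1 (fun x => x) (oner_neq0 _) (@measurable_id _ _ _).
have [mS' _] := @rescales_y 1 (fun x => - x) (oner_neq0 _) (@oppr_measurable R setT).
have SE : affine_map o (u + v) v = affine_map o u v \o (fun z => (z.1, 1 * z.2 + z.1)).
  by apply/funext => z; rewrite /= !affine_mapE /=; congr pair; ring.
have SE' : affine_map o u v = affine_map o (u + v) v \o (fun z => (z.1, 1 * z.2 - z.1)).
  by apply/funext => z; rewrite /= !affine_mapE /=; congr pair; ring.
have mA : measurable_fun [set: line * line] (affine_map o u v : _ -> line * line).
  by rewrite SE'; exact: measurableT_comp.
split=> // X mX.
have mAX : measurable ((affine_map o u v : _ -> line * line) @^-1` X).
  by rewrite -[_ @^-1` X]setTI; exact: mA.
by rewrite (hF X mX) (hS _ mAX) normr1 mul1e SE.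
Qed.

End PlaneMeasure.

(** * Integrals over the reference triangle *)

(** This holds at the infinities too, because fine sends both to 0 and k is
    positive. *)
Lemma fine_pZl (R : realDomainType) (k : R) (x : \bar R) :
  0 < k -> fine (k%:E * x) = k * fine x.
Proof.
move=> k0; case: x => [r| |] //=.
- by rewrite gt0_muley ?lte_fin// mulr0.
- by rewrite gt0_muleNy ?lte_fin// mulr0.
Qed.

(** The hypothesis says that mu is k times its pushforward by F. *)
Lemma ge0_Rintegral_rescale d (X : measurableType d) (R : realType)
    (mu : {measure set X -> \bar R}) (F : X -> X) (k : R) (K : set X) (f : X -> R) :
  0 < k -> measurable_fun setT F ->
  (forall A, measurable A -> mu A = (k%:E * mu (F @^-1` A))%E) ->
  measurable K -> measurable_fun setT f -> (forall x, K x -> 0 <= f x) ->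
  \int[mu]_(x in K) f x = k * \int[mu]_(x in F @^-1` K) f (F x).
Proof.
move=> k0 mF hF mK mf f0.
pose mF' := isMeasurableFun.Build _ _ _ _ F mF.
pose FF : {mfun X >-> X} := HB.pack F mF'.
pose kn : {nonneg R} := NngNum (ltW k0).
rewrite /Rintegral -fine_pZl//; congr fine.
have mEf : measurable_fun setT (fun x => (f x)%:E) by exact/measurable_EFinP.
rewrite (@eq_measure_integral _ _ _ _ (mscale kn (pushforward mu FF))); last first.
  by move=> A mA _; exact: hF.
rewrite ge0_integral_mscale//; last exact: measurable_funTS.
rewrite ge0_integral_pushforward//; first last.
- by move=> x /[!inE] Kx; rewrite lee_fin f0.
- exact: measurable_funTS.
Qed.

Section RefTriangle.
Variable R : realType.

Notation lam := (@lebesgue_measure R).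
Notation line := (measurableTypeR R).

Lemma integral_poly_deriv (P : {poly R}) (t : R) : 0 <= t ->
  (\int[lam]_(x in `[0%R, t]) ((P^`()).[x])%:E = (P.[t] - P.[0])%:E)%E.
Proof.
rewrite le_eqVlt => /predU1P[<-|t0].
  by rewrite set_itv1 integral_set1 subrr.
rewrite EFinB; apply: continuous_FTC2 => //.
- by apply: continuous_in_subspaceT => x _; exact: continuous_horner.
- split; first by move=> x _; exact: ex_derive.
  + exact/cvg_at_right_filter/continuous_horner.
  + exact/cvg_at_left_filter/continuous_horner.
- by move=> x _; rewrite derive1E derive_val.
Qed.

Definition ref_triangle : set (R * R) :=
  [set z | [/\ 0 <= z.1, 0 <= z.2 & z.1 + z.2 <= 1]].

Lemma measurable_ref_triangle : measurable (ref_triangle : set (line * line)).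
Proof.
have -> : (ref_triangle : set (line * line)) =
    fst @^-1` `[0, +oo[%classic `&` (snd @^-1` `[0, +oo[%classic `&`
    (fun z : line * line => z.1 + z.2 : line) @^-1` `]-oo, 1]%classic).
  apply/seteqP; split=> -[x y] /=; rewrite !in_itv /= ?andbT.
    by case.
  by move=> [? [? ?]]; split.
apply: measurableI; last apply: measurableI.
- by rewrite -[_ @^-1` _]setTI; exact: measurable_fst.
- by rewrite -[_ @^-1` _]setTI; exact: measurable_snd.
- rewrite -[_ @^-1` _]setTI; apply: measurable_funD => //.
Qed.

(** Tonelli: the slice of the reference triangle at abscissa x is the interval
    from 0 to 1 - x. The antiderivatives Q and S are given, so that every
    instance reduces to identities between polynomials. *)
Lemma integral2_ref_triangle (p Q S : {poly R}) :
  (forall x, 0 <= x -> 0 <= p.[x]) -> (forall x, 0 <= x -> 0 <= Q^`().[x]) ->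
  (forall x, S^`().[x] = p.[x] * (Q.[1 - x] - Q.[0])) ->
  integral2 ref_triangle (fun z => p.[z.1] * Q^`().[z.2]) = S.[1] - S.[0].
Proof.
move=> p0 q0 dS; rewrite /integral2 /Rintegral.
set f := fun z : line * line => (p.[z.1] * Q^`().[z.2])%:E.
have f_ge0 z : ref_triangle z -> (0 <= f z)%E.
  by move=> [z1 z2 _]; rewrite lee_fin mulr_ge0 ?p0 ?q0.
have mhorner (r : {poly R}) : measurable_fun [set: line] (fun x => r.[x] : line).
  by apply: continuous_measurable_fun; exact: continuous_horner.
have mf : measurable_fun [set: line * line] f.
  apply/measurable_EFinP; apply: measurable_funM.
  - apply: (measurableT_comp (mhorner p)); exact: measurable_fst.
  - apply: (measurableT_comp (mhorner Q^`())); exact: measurable_snd.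
rewrite integral_mkcond fubini_tonelli1; first last.
- by move=> z; rewrite patchE; case: ifPn => // /[!inE]; exact: f_ge0.
- apply/(measurable_restrictT _ _).1 => //; first exact: measurable_ref_triangle.
  exact: measurable_funTS.
rewrite -[RHS]/(fine (S.[1] - S.[0])%:E) -integral_poly_deriv ?ler01//.
congr fine; rewrite [RHS]integral_mkcond; apply: eq_integral => x _.
rewrite /fubini_F [RHS]patchE; case: ifPn => [|/negP]; rewrite inE /= in_itv /=.
  move=> /andP[x0 x1].
  have -> : (\int[lam]_y (f \_ ref_triangle) (x, y) =
      \int[lam]_(y in `[0%R, (1 - x)%R]) (p.[x]%:E * (Q^`().[y])%:E))%E.
    rewrite [RHS]integral_mkcond; apply: eq_integral => y _.
    rewrite !patchE; congr (if _ then _ else _).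
    apply/idP/idP; rewrite !inE /ref_triangle /= in_itv /=.
      by move=> [_ -> ?]; lra.
    by move=> /andP[? ?]; split => //; lra.
  rewrite ge0_integralZl//; first last.
  - by rewrite lee_fin p0.
  - by move=> y; rewrite /= in_itv /= lee_fin => /andP[? _]; exact: q0.
  - by apply/measurable_EFinP; apply: measurable_funTS; exact: mhorner.
  by rewrite integral_poly_deriv ?subr_ge0// -EFinM dS.
move=> x01; apply: integral0_eq => y _; rewrite patchE; case: ifPn => //.
by rewrite inE => -[/= ? ? ?]; exfalso; apply: x01; apply/andP; split; lra.
Qed.

Lemma ref_triangle_integral1 : integral2 ref_triangle (fun=> 1) = 2^-1.
Proof.
have -> : (fun=> 1) = (fun z : R * R => (1 : {poly R}).[z.1] * ('X : {poly R})^`().[z.2]).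
  by apply/funext => z; rewrite derivX !hornerE.
rewrite (@integral2_ref_triangle _ _ ('X - 2^-1 *: 'X^2)).
- by rewrite !hornerE /=; field.
- by move=> x _; rewrite hornerE ler01.
- by move=> x _; rewrite derivX hornerE ler01.
- by move=> x; rewrite derivB derivZ derivX derivXn !hornerE /=; field.
Qed.

Lemma ref_triangle_integral_x : integral2 ref_triangle (fun z => z.1) = 6^-1.
Proof.
have -> : (fun z => z.1) = (fun z : R * R => ('X : {poly R}).[z.1] * ('X : {poly R})^`().[z.2]).
  by apply/funext => z; rewrite derivX !hornerE.
rewrite (@integral2_ref_triangle _ _ (2^-1 *: 'X^2 - 3^-1 *: 'X^3)).
- by rewrite !hornerE /=; field.
- by move=> x x0; rewrite hornerE.
- by move=> x _; rewrite derivX hornerE ler01.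
- by move=> x; rewrite derivB !derivZ !derivXn !hornerE /=; field.
Qed.

Lemma ref_triangle_integral_xy : integral2 ref_triangle (fun z => z.1 * z.2) = 24^-1.
Proof.
have -> : (fun z => z.1 * z.2) =
    (fun z : R * R => ('X : {poly R}).[z.1] * (2^-1 *: 'X^2 : {poly R})^`().[z.2]).
  by apply/funext => z; rewrite derivZ derivXn !hornerE /=; field.
rewrite (@integral2_ref_triangle _ _ (4^-1 *: 'X^2 - 3^-1 *: 'X^3 + 8^-1 *: 'X^4)).
- by rewrite !hornerE /=; field.
- by move=> x x0; rewrite hornerE.
- by move=> x x0; rewrite derivZ derivXn !hornerE /=; lra.
- by move=> x; rewrite derivD derivB !derivZ !derivXn !hornerE /=; field.
Qed.

Lemma integral2_affine_map (o u v : R * R) (f : R * R -> R) (K : set (R * R)) :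
  cross u v != 0 -> measurable (K : set (line * line)) ->
  measurable_fun [set: line * line] (f : _ -> line) ->
  (forall x, K x -> 0 <= f x) -> affine_map o u v @^-1` K = ref_triangle ->
  integral2 K f = `|cross u v| * integral2 ref_triangle (f \o affine_map o u v).
Proof.
move=> e0 mK mf f0 KE; have [mF hF] := rescales_affine_map o e0.
rewrite /integral2 -KE; apply: ge0_Rintegral_rescale => //.
by rewrite normr_gt0.
Qed.
End RefTriangle.

(** * Continuous functions on a triangle *)

Section Triangle.
Variable R : realType.

Notation lam2 := (@lebesgue_measure R \x @lebesgue_measure R)%E.
Notation line := (measurableTypeR R).

(** An open set is the union of the countably many boxes with rational corners
    that it contains. *)
Lemma open_plane_measurable (U : set (R * R)) : open U -> measurable (U : set (line * line)).
Proof.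
move=> oU.
pose box (s : (rat * rat) * (rat * rat)) : set (line * line) :=
  `]ratr s.1.1, ratr s.1.2[%classic `*` `]ratr s.2.1, ratr s.2.2[%classic.
have -> : (U : set (line * line)) = \bigcup_s (if `[< box s `<=` U >] then box s else set0).
  apply/seteqP; split=> [z Uz|z [s _]]; last by case: ifPn => // /asboolP; exact.
  have /nbhs_ballP[e /= e0 eU] : nbhs z U by exact: open_nbhs_nbhs.
  have rat_near (x : R) : exists p : rat * rat,
      [/\ x - e < ratr p.1 < x & x < ratr p.2 < x + e].
    have [|p] := @rat_in_itvoo R (x - e) x; first by rewrite ltrBlDr ltrDl.
    have [|q] := @rat_in_itvoo R x (x + e); first by rewrite ltrDl.
    by rewrite !in_itv /= => q1 p1; exists (p, q).
  have [[p1 p2] /= [/andP[p11 p12] /andP[p21 p22]]] := rat_near z.1.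
  have [[q1 q2] /= [/andP[q11 q12] /andP[q21 q22]]] := rat_near z.2.
  exists ((p1, p2), (q1, q2)) => //; case: ifPn => [_|/asboolPn[]].
    by split; rewrite /= in_itv /= ?p12 ?p21 ?q12 ?q21.
  move=> y [/=]; rewrite !in_itv /= => /andP[y1 y2] /andP[y3 y4]; apply: eU.
  split; rewrite /ball /= ltr_norml; apply/andP; split; lra.
apply: countable_bigcupT_measurable; first exact: countableP.
by move=> s; case: ifPn => // _; apply: measurableX; exact: measurable_itv.
Qed.

Lemma closed_plane_measurable (K : set (R * R)) : closed K -> measurable (K : set (line * line)).
Proof. by move/closed_openC/open_plane_measurable/measurableC; rewrite setCK. Qed.

Lemma within_continuous_measurable (K : set (R * R)) (f : R * R -> R) : closed K ->
  {within K, continuous f} -> measurable_fun (K : set (line * line)) (f : _ -> line).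
Proof.
move=> cK /continuousP cf.
have mK := closed_plane_measurable cK.
move=> _; apply: (measurability _ (RGenOpens.measurableE R)) => //.
move=> _ [_ [a [b ->] <-]].
have oab : open (`]a, b[%classic : set R) by exact: interval_open.
have /open_subspaceP[V oV VK] := cf _ oab.
rewrite setIC -VK; apply: measurableI => //; exact: open_plane_measurable.
Qed.

(** The vertices are o, o + u and o + v. *)
Definition triangle (o u v : R * R) : set (R * R) := affine_map o u v @` @ref_triangle R.

Lemma affine_map_continuous (o u v : R * R) : continuous (affine_map o u v).
Proof.
move=> z; rewrite /affine_map.
apply: cvgD; first apply: cvgD; first exact: cvg_cst.
- by apply: cvgZr_tmp; exact: cvg_fst.
- by apply: cvgZr_tmp; exact: cvg_snd.
Qed.

Lemma affine_map_inj (o u v : R * R) : cross u v != 0 -> injective (affine_map o u v).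
Proof.
move=> e0 [x1 x2] [y1 y2]; rewrite !affine_mapE /= => -[E1 E2].
have F1 : (x1 - y1) * cross u v = 0.
  rewrite /cross; transitivity ((o.1 + x1 * u.1 + x2 * v.1 - (o.1 + y1 * u.1 + y2 * v.1)) * v.2
    - (o.2 + x1 * u.2 + x2 * v.2 - (o.2 + y1 * u.2 + y2 * v.2)) * v.1); first by ring.
  by rewrite E1 E2; ring.
have F2 : (x2 - y2) * cross u v = 0.
  rewrite /cross; transitivity ((o.2 + x1 * u.2 + x2 * v.2 - (o.2 + y1 * u.2 + y2 * v.2)) * u.1
    - (o.1 + x1 * u.1 + x2 * v.1 - (o.1 + y1 * u.1 + y2 * v.1)) * u.2); first by ring.
  by rewrite E1 E2; ring.
move/eqP: F1; rewrite mulf_eq0 (negPf e0) orbF subr_eq0 => /eqP ->.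
by move/eqP: F2; rewrite mulf_eq0 (negPf e0) orbF subr_eq0 => /eqP ->.
Qed.

Lemma ref_triangle_compact : compact (@ref_triangle R).
Proof.
have cbox : compact ((`[0, 1]%classic : set R) `*` (`[0, 1]%classic : set R)).
  by apply: compact_setX; exact: segment_compact.
apply: subclosed_compact cbox _; last first.
- by move=> z [z1 z2 z3]; split; rewrite /= in_itv /=; apply/andP; split; lra.
have -> : @ref_triangle R = fst @^-1` [set x | 0 <= x] `&` (snd @^-1` [set x | 0 <= x] `&`
    (fun z => z.1 + z.2) @^-1` [set x | x <= 1]).
  by apply/seteqP; split => z; [case | case=> ? []]; split.
apply: closedI; last apply: closedI.
- by apply: preimage_closed; [move=> z _; exact: cvg_fst | exact: closed_ge].
- by apply: preimage_closed; [move=> z _; exact: cvg_snd | exact: closed_ge].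
- apply: preimage_closed; last exact: closed_le.
  by move=> z _; apply: cvgD; [exact: cvg_fst | exact: cvg_snd].
Qed.

Lemma triangle_compact o u v : compact (triangle o u v).
Proof.
apply: continuous_compact; last exact: ref_triangle_compact.
by apply: continuous_subspaceT; exact: affine_map_continuous.
Qed.

Lemma triangle_closed o u v : closed (triangle o u v).
Proof. by apply: compact_closed; [exact: norm_hausdorff | exact: triangle_compact]. Qed.

Lemma triangle_measurable o u v : measurable (triangle o u v : set (line * line)).
Proof. by apply: closed_plane_measurable; exact: triangle_closed. Qed.

Lemma preimage_triangle o u v : cross u v != 0 ->
  affine_map o u v @^-1` triangle o u v = @ref_triangle R.
Proof.
move=> e0; apply/seteqP; split=> z /=; last by move=> ?; exists z.
by move=> [y ? /(affine_map_inj e0) <-].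
Qed.

Lemma triangle_area o u v : cross u v != 0 -> area (triangle o u v) = `|cross u v| / 2.
Proof.
move=> e0.
have := @integral2_affine_map _ o u v (fun=> 1) _ e0 (triangle_measurable o u v)
  (@measurable_cst _ _ (line * line)%type line setT 1) (fun _ _ => ler01) (preimage_triangle o e0).
rewrite [_ \o _](_ : _ = fun=> 1)// ref_triangle_integral1 => <-.
rewrite /integral2 Rintegral_cst ?mul1r//; exact: triangle_measurable.
Qed.

(** The real number area is nonzero, whereas an infinite measure would be read
    as 0. *)
Lemma triangle_lty o u v : cross u v != 0 -> (lam2 (triangle o u v) < +oo)%E.
Proof.
move=> e0; have := triangle_area o e0; rewrite /area /lebesgue2.
have : (0 <= lam2 (triangle o u v))%E by exact: measure_ge0.
case: (lam2 _) => [r _ _|_ /= /esym/eqP|//]; first exact: ltry.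
by rewrite mulf_eq0 normr_eq0 (negPf e0) /= invr_eq0 pnatr_eq0.
Qed.

Lemma triangle_integrable o u v (f : R * R -> R) : cross u v != 0 ->
  {within triangle o u v, continuous f} -> lam2.-integrable (triangle o u v) (EFin \o f).
Proof.
move=> e0 cf; apply: measurable_bounded_integrable.
- exact: triangle_measurable.
- exact: triangle_lty.
- by apply: within_continuous_measurable => //; exact: triangle_closed.
have /compact_bounded[M [_ mrt]] := continuous_compact cf (@triangle_compact o u v).
by exists M; split; rewrite ?num_real // => ? ? ? ?; exact: mrt.
Qed.

(** Here f is the barycentric coordinate that equals 1 at the vertex o + u; its
    mean value is 1 / 3. *)
Lemma triangle_integral_bary o u v (f : R * R -> R) : cross u v != 0 ->
  measurable_fun [set: line * line] (f : _ -> line) ->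
  (forall z, f (affine_map o u v z) = z.1) ->
  integral2 (triangle o u v) f = area (triangle o u v) / 3.
Proof.
move=> e0 mf fE; rewrite triangle_area// (@integral2_affine_map R o u v) //; first last.
- exact: preimage_triangle.
- by move=> _ [z [z1 _ _] <-]; rewrite fE.
- exact: triangle_measurable.
have -> : f \o affine_map o u v = fst by apply/funext => z; rewrite /= fE.
by rewrite ref_triangle_integral_x; field.
Qed.

(** Here f is the product of the barycentric coordinates of the vertices o + u
    and o + v. *)
Lemma triangle_integral_bary2 o u v (f : R * R -> R) : cross u v != 0 ->
  measurable_fun [set: line * line] (f : _ -> line) ->
  (forall z, f (affine_map o u v z) = z.1 * z.2) ->
  integral2 (triangle o u v) f = area (triangle o u v) / 12.
Proof.
move=> e0 mf fE; rewrite triangle_area// (@integral2_affine_map R o u v) //; first last.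
- exact: preimage_triangle.
- by move=> _ [z [z1 z2 _] <-]; rewrite fE mulr_ge0.
- exact: triangle_measurable.
have -> : f \o affine_map o u v = fun z => z.1 * z.2 by apply/funext => z; rewrite /= fE.
by rewrite ref_triangle_integral_xy; field.
Qed.

Section Integral.
Variables (o u v : R * R).
Hypothesis e0 : cross u v != 0.
Notation K := (triangle o u v).
Notation cont f := {within K, continuous f}.

Lemma integral2D (f g : R * R -> R) : cont f -> cont g ->
  integral2 K (fun x => f x + g x) = integral2 K f + integral2 K g.
Proof.
move=> cf cg; apply: RintegralD; first exact: triangle_measurable.
- exact: triangle_integrable.
- exact: triangle_integrable.
Qed.

Lemma integral2Z k (f : R * R -> R) : cont f ->
  integral2 K (fun x => k * f x) = k * integral2 K f.
Proof.
move=> cf; apply: RintegralZl; first exact: triangle_measurable.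
exact: triangle_integrable.
Qed.

(** The triangle shrunk towards x0 by a small factor t lies in the triangle and
    in a neighbourhood of x0, and has positive area; this covers points x0 of
    the boundary. *)
Lemma integral2_gt0 (f : R * R -> R) x0 : cont f -> (forall x, K x -> 0 <= f x) ->
  K x0 -> 0 < f x0 -> 0 < integral2 K f.
Proof.
move=> cf f0 Kx0 fx0.
have hx0 : 0 < f x0 / 2 by rewrite divr_gt0.
have cx0 : f @ within K (nbhs x0) --> f x0.
  by move: cf => /subspace_continuousP; apply.
have : \forall y \near within K (nbhs x0), `|f x0 - f y| < f x0 / 2.
  by move/cvgrPdist_lt : cx0; apply.
rewrite near_withinE => /nbhs_ballP[d /= d0 df].
have [M [_ KM]] := compact_bounded (@triangle_compact o u v).
pose B := `|M| + `|M| + 2.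
have B0 : 0 < B by rewrite /B; have := normr_ge0 M; lra.
have KB y : K y -> `|y| < B.
  move=> Ky; have := KM (`|M| + 1) _ y Ky => /(_ _)/le_lt_trans; apply.
    by rewrite (le_lt_trans (ler_norm M))// ltrDl.
  by rewrite /B; have := normr_ge0 M; lra.
pose t := Num.min 1 (d / (2 * B)).
have t0 : 0 < t by rewrite lt_min ltr01 divr_gt0// mulr_gt0.
have t1 : t <= 1 by rewrite ge_min lexx.
pose o' := (1 - t) *: x0 + t *: o.
have Kt z : affine_map o' (t *: u) (t *: v) z = (1 - t) *: x0 + t *: affine_map o u v z.
  by apply: injective_projections; rewrite /affine_map /o' /= /GRing.scale /=; ring.
pose K' := triangle o' (t *: u) (t *: v).
have e0' : cross (t *: u) (t *: v) != 0.
  rewrite (_ : cross _ _ = t ^+ 2 * cross u v); last by rewrite /cross /= /GRing.scale /=; ring.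
  by rewrite mulf_neq0// expf_neq0// gt_eqF.
have K'K y : K' y -> K y /\ f x0 / 2 <= f y.
  move=> [z rz <-]; have Kw : K (affine_map o u v z) by exists z.
  have Ky : K (affine_map o' (t *: u) (t *: v) z).
    rewrite Kt; have [z0 [z01 z02 z03] <-] := Kx0; have [z1 z2 z3] := rz.
    exists ((1 - t) *: z0 + t *: z); last first.
      by apply: injective_projections; rewrite /affine_map /= /GRing.scale /=; ring.
    split=> /=; rewrite /GRing.scale /=; first nra; first nra; nra.
  split=> //; have : `|f x0 - f (affine_map o' (t *: u) (t *: v) z)| < f x0 / 2.
    apply: df => //; rewrite -ball_normE /ball_ /= Kt.
    rewrite (_ : _ - _ = t *: (x0 - affine_map o u v z)); last first.
      by apply: injective_projections; rewrite /affine_map /= /GRing.scale /=; ring.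
    rewrite normrZ (gtr0_norm t0).
    apply: (@lt_le_trans _ _ (t * (2 * B))).
      rewrite ltr_pM2l// (le_lt_trans (ler_normB _ _))//.
      by have := KB _ Kx0; have := KB _ Kw; lra.
    by rewrite -ler_pdivlMr ?mulr_gt0// ge_min lexx orbT.
  by rewrite ltr_norml => /andP[]; lra.
have cK' : {within K', continuous f} by apply: continuous_subspaceW cf => y /K'K[].
have : 0 < f x0 / 2 * area K' by rewrite triangle_area// mulr_gt0// divr_gt0// normr_gt0.
move=> /lt_le_trans; apply.
have mf : measurable_fun (K : set (line * line)) (EFin \o f).
  by apply/measurable_EFinP; exact: (within_continuous_measurable (@triangle_closed o u v) cf).
have mK := @triangle_measurable o u v.
have mK' := @triangle_measurable o' (t *: u) (t *: v).
have <- := Rintegral_cst lam2 mK' (f x0 / 2).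
rewrite /integral2 /Rintegral fine_le//.
- apply: integrable_fin_num; [exact: mK'|].
  apply: (triangle_integrable (f := fun=> f x0 / 2) e0').
  by apply: continuous_subspaceT => x; exact: cvg_cst.
- by apply: integrable_fin_num; [exact: mK|exact: triangle_integrable].
have K'sub : K' `<=` K by move=> y /K'K[].
apply: (@le_trans _ _ (\int[lam2]_(x in K') (f x)%:E)%E).
  apply: ge0_le_integral => //.
  - by move=> y _; rewrite lee_fin ltW.
  - by apply: measurable_funS mf.
  - by move=> y /K'K[_]; rewrite lee_fin.
apply: ge0_subset_integral => // y Ky; rewrite lee_fin; exact: f0.
Qed.
End Integral.

Lemma within_mul (A : set (R * R)) (h1 h2 : R * R -> R) :
  {within A, continuous h1} -> {within A, continuous h2} ->
  {within A, continuous (fun x => h1 x * h2 x)}.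
Proof. by move=> c1 c2 x; apply: cvgM; [exact: c1|exact: c2]. Qed.

Lemma within_add (A : set (R * R)) (h1 h2 : R * R -> R) :
  {within A, continuous h1} -> {within A, continuous h2} ->
  {within A, continuous (fun x => h1 x + h2 x)}.
Proof. by move=> c1 c2 x; apply: cvgD; [exact: c1|exact: c2]. Qed.

Lemma within_sub (A : set (R * R)) (h1 h2 : R * R -> R) :
  {within A, continuous h1} -> {within A, continuous h2} ->
  {within A, continuous (fun x => h1 x - h2 x)}.
Proof. by move=> c1 c2 x; apply: cvgB; [exact: c1|exact: c2]. Qed.

Lemma within_cst (A : set (R * R)) (r : R) : {within A, continuous (fun=> r)}.
Proof. by move=> x; exact: cvg_cst. Qed.

Lemma eq_integral2 (A : set (R * R)) (h1 h2 : R * R -> R) : (forall x, A x -> h1 x = h2 x) ->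
  integral2 A h1 = integral2 A h2.
Proof. by move=> fg; apply: eq_Rintegral => x /[!inE]; exact: fg. Qed.

Lemma integral2_ge0 (A : set (R * R)) (h : R * R -> R) :
  (forall x, A x -> 0 <= h x) -> 0 <= integral2 A h.
Proof. by move=> h0; apply: Rintegral_ge0. Qed.

End Triangle.

(** * Vectors of the plane *)

Section PlaneVectors.
Variable R : realType.
Implicit Types (p q w : 'cV[R]_2) (x y u v : R * R).

Lemma dotE p q : dot p q = p 0 0 * q 0 0 + p 1 0 * q 1 0.
Proof.
rewrite /dot mxE big_ord_recl big_ord1 !mxE.
by rewrite (_ : lift ord0 ord0 = 1)//; apply: val_inj.
Qed.

Lemma vec_0 x : vec x 0 0 = x.1. Proof. by rewrite mxE. Qed.
Lemma vec_1 x : vec x 1 0 = x.2. Proof. by rewrite mxE. Qed.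

Lemma dot_vec q x : dot q (vec x) = q 0 0 * x.1 + q 1 0 * x.2.
Proof. by rewrite dotE vec_0 vec_1. Qed.

Lemma cV2P p q : p 0 0 = q 0 0 -> p 1 0 = q 1 0 -> p = q.
Proof.
move=> h0 h1; apply/colP => i; have [->//|->//] : i = 0 \/ i = 1.
by case: i => -[|[|//]] hi; [left|right]; apply: val_inj.
Qed.

Lemma dotDl p q w : dot (p + q) w = dot p w + dot q w.
Proof. by rewrite !dotE !mxE; ring. Qed.

Lemma dotDr p q w : dot p (q + w) = dot p q + dot p w.
Proof. by rewrite !dotE !mxE; ring. Qed.

Lemma dotZl k p w : dot (k *: p) w = k * dot p w.
Proof. by rewrite !dotE !mxE; ring. Qed.

Lemma dotZr k p w : dot p (k *: w) = k * dot p w.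
Proof. by rewrite !dotE !mxE; ring. Qed.

Lemma dot0l w : dot 0 w = 0.
Proof. by rewrite dotE !mxE; ring. Qed.

Lemma dot0r w : dot w 0 = 0.
Proof. by rewrite dotE !mxE; ring. Qed.

Lemma dot_suml (I : finType) (P : pred I) (F : I -> 'cV[R]_2) w :
  dot (\sum_(i | P i) F i) w = \sum_(i | P i) dot (F i) w.
Proof. by elim/big_rec2: _ => [|i y1 y2 _ <-]; rewrite ?dot0l ?dotDl. Qed.

Lemma dot_sumr (I : finType) (P : pred I) (F : I -> 'cV[R]_2) w :
  dot w (\sum_(i | P i) F i) = \sum_(i | P i) dot w (F i).
Proof. by elim/big_rec2: _ => [|i y1 y2 _ <-]; rewrite ?dot0r ?dotDr. Qed.

Lemma dot_ge0 p : 0 <= dot p p.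
Proof. by rewrite dotE addr_ge0// -expr2 sqr_ge0. Qed.

Lemma enorm_ge0 p : 0 <= enorm p.
Proof. exact: sqrtr_ge0. Qed.

Lemma enorm_sqr p : enorm p ^+ 2 = dot p p.
Proof. by rewrite sqr_sqrtr// dot_ge0. Qed.

Lemma enorm_eq0 p : (enorm p == 0) = (p == 0).
Proof.
rewrite -(@eqrXn2 _ 2%N)// ?enorm_ge0// enorm_sqr expr0n /= dotE -!expr2.
rewrite paddr_eq0 ?sqr_ge0// !sqrf_eq0; apply/andP/eqP => [[/eqP h0 /eqP h1]|->].
  by apply: cV2P; rewrite mxE.
by rewrite !mxE.
Qed.

Lemma cauchy_schwarz p q : dot p q <= enorm p * enorm q.
Proof.
have [h|h] := leP (dot p q) 0; first by rewrite (le_trans h)// mulr_ge0// enorm_ge0.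
rewrite -(@ler_pXn2r _ 2%N)// ?nnegrE ?mulr_ge0 ?enorm_ge0 ?(ltW h)//.
rewrite exprMn !enorm_sqr !dotE -subr_ge0.
rewrite (_ : _ - _ = (p 0 0 * q 1 0 - p 1 0 * q 0 0) ^+ 2) ?sqr_ge0//; ring.
Qed.

(** The squared norm of p - (B / enorm q) *: q is enorm p ^+ 2 - B ^+ 2, which
    is at most 0. *)
Lemma cauchy_schwarz_eq p q (B : R) : q != 0 -> enorm p <= B -> dot p q = B * enorm q ->
  p = (B / enorm q) *: q.
Proof.
move=> q0 pB pq; have n0 : 0 < enorm q by rewrite lt_def enorm_eq0 q0 enorm_ge0.
have B0 : 0 <= B := le_trans (enorm_ge0 p) pB.
have := dot_ge0 (p - (B / enorm q) *: q).
have -> : dot (p - (B / enorm q) *: q) (p - (B / enorm q) *: q) =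
  enorm p ^+ 2 - B ^+ 2.
  rewrite -scaleNr !(dotDl, dotDr, dotZl, dotZr) -enorm_sqr.
  rewrite (_ : dot q p = dot p q); last by rewrite !dotE; ring.
  by rewrite pq -enorm_sqr; field; rewrite gt_eqF.
move=> h; have pB2 : enorm p ^+ 2 - B ^+ 2 = 0.
  apply: le_anti; rewrite h andbT subr_le0 ler_pXn2r// nnegrE//; exact: enorm_ge0.
apply/eqP; rewrite -subr_eq0 -enorm_eq0 -sqrf_eq0 enorm_sqr.
rewrite -scaleNr !(dotDl, dotDr, dotZl, dotZr) -enorm_sqr.
rewrite (_ : dot q p = dot p q); last by rewrite !dotE; ring.
rewrite pq -enorm_sqr -pB2; apply/eqP; field; rewrite gt_eqF//.
Qed.

Lemma vecD x y : vec (x + y) = vec x + vec y.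
Proof. by apply/colP => i; rewrite !mxE; case: ifP. Qed.

Lemma vecZ (s : R) x : vec (s *: x) = s *: vec x.
Proof. by apply/colP => i; rewrite !mxE; case: ifP. Qed.

Lemma vec0 : vec (0 : R * R) = 0.
Proof. by apply/colP => i; rewrite !mxE; case: ifP. Qed.

Lemma vec_sum (I : finType) (P : pred I) (F : I -> R * R) :
  vec (\sum_(i | P i) F i) = \sum_(i | P i) vec (F i).
Proof. by elim/big_rec2: _ => [|i y1 y2 _ <-]; rewrite ?vec0 ?vecD. Qed.

Lemma dot_vecB g x y : dot g (vec (x - y)) = dot g (vec x) - dot g (vec y).
Proof. by rewrite !dot_vec /=; ring. Qed.

Lemma vec_dot_inj (u v : R * R) (p q : 'cV[R]_2) : cross u v != 0 ->
  dot p (vec u) = dot q (vec u) -> dot p (vec v) = dot q (vec v) -> p = q.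
Proof.
rewrite !dot_vec => e0 hu hv; have := e0; rewrite /cross => e0'.
apply: cV2P; apply: (mulIf e0); rewrite /cross.
- transitivity ((p 0 0 * u.1 + p 1 0 * u.2) * v.2 - (p 0 0 * v.1 + p 1 0 * v.2) * u.2); first by ring.
  by rewrite hu hv; ring.
- transitivity ((p 0 0 * v.1 + p 1 0 * v.2) * u.1 - (p 0 0 * u.1 + p 1 0 * u.2) * v.1); first by ring.
  by rewrite hu hv; ring.
Qed.

End PlaneVectors.

(** * Nodal functions as barycentric coordinates *)

Section Mesh.
Variables (R : realType) (Omega : set (R * R)) (Nvi Nv : nat) (a : 'I_Nv -> R * R).
Variables (T : {set {set 'I_Nv}}) (phi : 'I_Nv -> R * R -> R).
Hypothesis Hmesh : conforming_mesh Omega Nvi a T.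
Hypothesis Hphi : nodal_basis Omega a T phi.
Implicit Types (K : {set 'I_Nv}) (x y : R * R) (i j k l : 'I_Nv).

Notation hull := (conv_hull a).
Notation grad K j := (grad_on (conv_hull a K) (phi j)).

Lemma vertex_in_hull K l : l \in K -> hull K (a l).
Proof.
move=> lK; exists (fun l' => (l' == l)%:R); split=> [i _||]; first by rewrite ler0n.
  rewrite (bigD1 l)//= eqxx big1 ?addr0// => i /andP[_ /negPf ->]//.
rewrite (bigD1 l)//= eqxx scale1r big1 ?addr0// => i /andP[_ /negPf ->]; exact: scale0r.
Qed.

Lemma affine_on_hull K (v : R * R -> R) g (w : 'I_Nv -> R) : has_gradient_on (hull K) v g ->
  (forall l, l \in K -> 0 <= w l) -> \sum_(l in K) w l = 1 ->
  v (\sum_(l in K) w l *: a l) = \sum_(l in K) w l * v (a l).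
Proof.
move=> [m hm] w0 w1; rewrite hm; last by exists w.
rewrite vec_sum dot_sumr.
rewrite [RHS](eq_bigr (fun l => w l * dot g (vec (a l)) + w l * m)); last first.
  by move=> l lK; rewrite hm ?mulrDr//; exact: vertex_in_hull.
rewrite big_split /= -mulr_suml w1 mul1r; congr (_ + _).
by apply: eq_bigr => l _; rewrite vecZ dotZr.
Qed.

Lemma phi_gradient K j : K \in T -> has_gradient_on (hull K) (phi j) (grad K j).
Proof.
move=> KT; have [_ /(_ K KT) [q hq] _] := Hphi j.
exact: (@getPex _ [set q | has_gradient_on (hull K) (phi j) q] (ex_intro _ q hq)).
Qed.

Lemma phi_vertex j k : phi j (a k) = (j == k)%:R.
Proof. by have [_ _ ->] := Hphi j. Qed.

(** Both sides are affine on the element and agree at its vertices. In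
    particular phi l can be positive at a point of K only if l is a vertex of K;
    this is how different elements are compared below. *)
Lemma phi_bary K l (w : 'I_Nv -> R) : K \in T ->
  (forall l, l \in K -> 0 <= w l) -> \sum_(l in K) w l = 1 ->
  phi l (\sum_(l in K) w l *: a l) = if l \in K then w l else 0.
Proof.
move=> KT w0 w1; rewrite (affine_on_hull (phi_gradient l KT))//.
under eq_bigr do rewrite phi_vertex.
case: ifPn => lK.
  rewrite (bigD1 l)//= eqxx mulr1 big1 ?addr0// => i /andP[_ il].
  by rewrite eq_sym (negPf il) mulr0.
rewrite big1// => i iK; rewrite (_ : l == i = false) ?mulr0//.
by apply: contraNF lK => /eqP ->.
Qed.

Lemma phi_notin K l x : K \in T -> hull K x -> l \notin K -> phi l x = 0.
Proof. by move=> KT [w [w0 w1 ->]] /negPf lK; rewrite phi_bary// lK. Qed.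

Lemma phi_ge0 K l x : K \in T -> hull K x -> 0 <= phi l x.
Proof. by move=> KT [w [w0 w1 ->]]; rewrite phi_bary//; case: ifP => //; exact: w0. Qed.

Lemma phi_sum_in K x : K \in T -> hull K x -> \sum_(l in K) phi l x = 1.
Proof.
move=> KT [w [w0 w1 ->]]; rewrite -[RHS]w1.
by apply: eq_bigr => l lK; rewrite phi_bary// lK.
Qed.

Lemma phi_sum K x : K \in T -> hull K x -> \sum_l phi l x = 1.
Proof.
move=> KT Kx; rewrite -(phi_sum_in KT Kx) [RHS]big_mkcond /=.
by apply: eq_bigr => l _; case: ifPn => // /(phi_notin KT Kx).
Qed.

Lemma phi_comb K x : K \in T -> hull K x -> x = \sum_(l in K) phi l x *: a l.
Proof.
move=> KT [w [w0 w1 ->]]; apply: eq_bigr => l lK; by rewrite phi_bary// lK.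
Qed.

Lemma has_gradientB K v g x y : has_gradient_on (hull K) v g -> hull K x -> hull K y ->
  v x - v y = dot g (vec x) - dot g (vec y).
Proof. by move=> [m hm] Kx Ky; rewrite !hm//; ring. Qed.

Lemma elementP K i j : K \in T -> i \in K -> j \in K -> i != j ->
  exists k, [/\ k != i, k != j & K = [set i; j; k]%SET].
Proof.
move=> KT iK jK ij; have K3 := mesh_card Hmesh KT.
have : #|(K :\ i :\ j)%SET| == 1%N.
  have := cardsD1 i K; have := cardsD1 j (K :\ i)%SET.
  by rewrite K3 iK !inE eq_sym ij jK /= => -> [->].
move=> /cards1P[k Kk]; exists k.
have : k \in (K :\ i :\ j)%SET by rewrite Kk !inE.
rewrite !inE => /and3P[kj ki kK]; split=> //.
apply/setP => l; rewrite !inE.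
have : (l \in (K :\ i :\ j)%SET) = (l == k) by rewrite Kk inE.
rewrite !inE.
have [->|li] /= := eqVneq l i; first by rewrite iK.
by have [->|lj] /= := eqVneq l j; first by rewrite jK.
Qed.

Lemma sum_set3 (V : nmodType) (F : 'I_Nv -> V) i j k : i != j -> k != i -> k != j ->
  \sum_(l in [set i; j; k]%SET) F l = F i + F j + F k.
Proof.
move=> ij ki kj; rewrite (finset.setUC _ [set k]%SET) big_setU1 ?inE ?negb_or ?ki ?kj//=.
by rewrite big_setU1 ?inE// big_set1 addrC.
Qed.

Lemma hull_triangle K i j k : i != j -> k != i -> k != j -> K = [set i; j; k]%SET ->
  hull K = triangle (a k) (a i - a k) (a j - a k).
Proof.
move=> ij ki kj ->; apply/seteqP; split=> [x [w [w0 w1 ->]]|_ [z [z1 z2 z3] <-]].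
  move: w1; rewrite !(sum_set3 _ ij ki kj) => w1.
  exists (w i, w j).
    split; rewrite /= ?w0 ?inE ?eqxx ?orbT// -w1 lerDl w0// !inE eqxx ?orbT//.
  have -> : w k = 1 - w i - w j by rewrite -w1; ring.
  by apply: injective_projections; rewrite /affine_map /= /GRing.scale /=; ring.
have ji : (j == i) = false by rewrite eq_sym; exact: negPf.
exists (fun l => if l == i then z.1 else if l == j then z.2 else 1 - z.1 - z.2).
split.
- move=> l _; case: ifP => // _; case: ifP => // _; lra.
- by rewrite (sum_set3 _ ij ki kj) !eqxx ji (negPf ki) (negPf kj); ring.
- rewrite (sum_set3 _ ij ki kj) !eqxx ji (negPf ki) (negPf kj).
  by apply: injective_projections; rewrite /affine_map /= /GRing.scale /=; ring.
Qed.

Lemma grad_vertex K l j k : K \in T -> j \in K -> k \in K ->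
  dot (grad K l) (vec (a j - a k)) = (l == j)%:R - (l == k)%:R.
Proof.
move=> KT jK kK; rewrite dot_vecB -(has_gradientB (phi_gradient l KT)) ?phi_vertex//;
  exact: vertex_in_hull.
Qed.

(** The gradients are dual to the edge vectors, so the product of the two
    determinants is 1. *)
Lemma element_cross_neq0 K i j k : K \in T -> i != j -> k != i -> k != j ->
  K = [set i; j; k]%SET -> cross (a i - a k) (a j - a k) != 0.
Proof.
move=> KT ij ki kj KE.
have iK : i \in K by rewrite KE !inE eqxx.
have jK : j \in K by rewrite KE !inE eqxx orbT.
have kK : k \in K by rewrite KE !inE eqxx !orbT.
have := grad_vertex i KT iK kK; have := grad_vertex i KT jK kK.
have := grad_vertex j KT iK kK; have := grad_vertex j KT jK kK.
rewrite !eqxx (eq_sym j i) (negPf ij) (eq_sym i k) (negPf ki) (eq_sym j k) (negPf kj) !dot_vec mulr1n mulr0n !subr0.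
set qi := grad K i; set qj := grad K j; set u := a i - a k; set v := a j - a k.
move=> jj ji ij' ii; apply/eqP => e0.
have : (qi 0 0 * qj 1 0 - qi 1 0 * qj 0 0) * cross u v = 1.
  transitivity ((qi 0 0 * u.1 + qi 1 0 * u.2) * (qj 0 0 * v.1 + qj 1 0 * v.2) -
    (qi 0 0 * v.1 + qi 1 0 * v.2) * (qj 0 0 * u.1 + qj 1 0 * u.2)).
    by rewrite /cross; ring.
  by rewrite jj ji ij' ii; ring.
by rewrite e0 mulr0 => /eqP; rewrite eq_sym oner_eq0.
Qed.

Lemma element_vertices K : K \in T ->
  exists i j k, [/\ i != j, k != i, k != j & K = [set i; j; k]%SET].
Proof.
move=> KT; have K3 := mesh_card Hmesh KT.
have /card_gt1P[i [j [iK jK ij]]] : (1 < #|K|)%N by rewrite K3.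
by have [k [ki kj KE]] := elementP KT iK jK ij; exists i, j, k.
Qed.

(** The operator grad_on chooses some gradient; uniqueness makes it linear in
    the function. *)
Lemma gradient_unique K (v : R * R -> R) p q : K \in T ->
  has_gradient_on (hull K) v p -> has_gradient_on (hull K) v q -> p = q.
Proof.
move=> KT hp hq; have [i [j [k [ij ki kj KE]]]] := element_vertices KT.
have hl l : l \in K -> hull K (a l) by exact: vertex_in_hull.
apply: (vec_dot_inj (element_cross_neq0 KT ij ki kj KE)); rewrite !dot_vecB
  -(has_gradientB hp) -?(has_gradientB hq)//; apply: hl; by rewrite KE !inE eqxx ?orbT.
Qed.

Lemma grad_notin K l : K \in T -> l \notin K -> grad K l = 0.
Proof.
move=> KT lK; apply: (gradient_unique KT (phi_gradient l KT)).
by exists 0 => x Kx; rewrite dot0l (phi_notin KT Kx lK) addr0.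
Qed.

Lemma gradient_sum K (I : finType) (P : pred I) (F : I -> R * R -> R) (p : I -> 'cV[R]_2) (w : I -> R) :
  (forall s, has_gradient_on (hull K) (F s) (p s)) ->
  has_gradient_on (hull K) (fun x => \sum_(s | P s) w s * F s x) (\sum_(s | P s) w s *: p s).
Proof.
move=> /choice[m hm]; exists (\sum_(s | P s) w s * m s) => x Kx.
rewrite dot_suml -big_split /=; apply: eq_bigr => i _; rewrite hm// dotZl; ring.
Qed.

Lemma grad_fe K (u : 'I_Nv -> R) (P : pred 'I_Nv) : K \in T ->
  grad_on (hull K) (fun x => \sum_(j | P j) u j * phi j x) = \sum_(j | P j) u j *: grad K j.
Proof.
move=> KT; have h := gradient_sum P u (fun j => phi_gradient j KT).
apply: (gradient_unique KT _ h).
exact: (@getPex _ [set q | has_gradient_on (hull K) _ q] (ex_intro _ _ h)).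
Qed.

Lemma grad_sum K : K \in T -> \sum_j grad K j = 0.
Proof.
move=> KT; have h := gradient_sum xpredT (fun=> 1) (fun j => phi_gradient j KT).
under eq_bigr do rewrite -[grad K _]scale1r.
apply: (gradient_unique KT h); exists 1 => x Kx.
by rewrite dot0l add0r -[RHS](phi_sum KT Kx); apply: eq_bigr => j _; rewrite mul1r.
Qed.

Lemma hull_closed K : K \in T -> closed (hull K).
Proof.
move=> KT; have [i [j [k [ij ki kj KE]]]] := element_vertices KT.
by rewrite (hull_triangle ij ki kj KE); exact: triangle_closed.
Qed.

Lemma hull_sub K : K \in T -> hull K `<=` closure Omega.
Proof. by move=> KT x Kx; rewrite (mesh_cover Hmesh); exists K. Qed.

End Mesh.

(** * The two elements that share an edge *)

Section MeshTopology.
Variables (R : realType) (Omega : set (R * R)) (Nvi Nv : nat) (a : 'I_Nv -> R * R).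
Variables (T : {set {set 'I_Nv}}) (phi : 'I_Nv -> R * R -> R).
Hypothesis Hmesh : conforming_mesh Omega Nvi a T.
Hypothesis Hphi : nodal_basis Omega a T phi.
Hypothesis oOmega : open Omega.
Implicit Types (K : {set 'I_Nv}) (x y : R * R) (i j k l : 'I_Nv).

Notation hull := (conv_hull a).
Notation grad K j := (grad_on (conv_hull a K) (phi j)).

(** The finitely many elements that do not contain x are closed, so some ball
    around x avoids them all. *)
Lemma near_element x : Omega x -> exists2 d : R, 0 < d &
  forall y, ball x d y -> exists K, [/\ K \in T, hull K x & hull K y].
Proof.
move=> Ox.
have far K : nbhs x [set y | K \in T -> ~ hull K x -> ~ hull K y].
  have [KT|KT] := boolP (K \in T); last by apply: filterE => y f.
  have [Kx|Kx] := pselect (hull K x); first by apply: filterE => y _ /(_ Kx).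
  have : nbhs x (~` hull K).
    by apply: open_nbhs_nbhs; split=> //; apply: closed_openC; exact: (hull_closed Hmesh KT).
  by apply: filterS => y Ky _ _.
have : \forall y \near x, Omega y /\ forall K, K \in T -> ~ hull K x -> ~ hull K y.
  apply: filterI; first by apply: open_nbhs_nbhs.
  exact: (filter_forall _ far).
move=> /nbhs_ballP[d /= d0 dx]; exists d => // y /dx [Oy hy].
have : closure Omega y by exact: subset_closure.
rewrite (mesh_cover Hmesh) => -[K /= KT Ky]; exists K; split=> //.
by apply: contrapT => Kx; exact: hy Kx Ky.
Qed.

Lemma interior_vertex_Omega i : (i < Nvi)%N -> Omega (a i).
Proof.
move=> iN; have := (mesh_interior_first Hmesh i).1 iN.
have [K KT iK] := mesh_vertex_used Hmesh i.
have cl : closure Omega (a i) by apply: (hull_sub Hmesh KT); exact: vertex_in_hull.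
by move=> h; apply: interior_subset; apply: contrapT => h'; apply: h; split.
Qed.

Lemma phi_pos_in K l x : K \in T -> hull K x -> 0 < phi l x -> l \in K.
Proof.
by move=> KT Kx; apply: contraTT => /(phi_notin Hphi KT Kx) ->; rewrite ltxx.
Qed.

Lemma hull_segment K x y (s : R) : hull K x -> hull K y -> 0 <= s <= 1 ->
  hull K (x + s *: (y - x)).
Proof.
move=> [w [w0 w1 ->]] [z [z0 z1 ->]] /andP[s0 s1].
exists (fun l => (1 - s) * w l + s * z l); split.
- by move=> l lK; rewrite addr_ge0// mulr_ge0 ?subr_ge0 ?w0 ?z0.
- by rewrite big_split /= -!mulr_sumr w1 z1; ring.
- under [RHS]eq_bigr do rewrite scalerDl -!scalerA.
  rewrite big_split /= -!scaler_sumr.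
  by apply: injective_projections; rewrite /= /GRing.scale /=; ring.
Qed.

Lemma phi_shift K l x y : K \in T -> hull K x -> hull K y ->
  phi l y = phi l x + dot (grad K l) (vec (y - x)).
Proof.
move=> KT Kx Ky; rewrite dot_vecB -(has_gradientB (phi_gradient Hphi l KT) Ky Kx); ring.
Qed.

Lemma ball_step x (w : R * R) (d : R) : 0 < d ->
  exists2 s : R, 0 < s < 1 & ball x d (x + s *: w).
Proof.
move=> d0; have w1 : 0 < `|w| + 1 by rewrite ltr_wpDl.
exists (Num.min 2^-1 (d / (`|w| + 1))).
  by rewrite lt_min invr_gt0 ltr0n divr_gt0//= gt_min; apply/orP; left; lra.
set s := Num.min _ _; have s0 : 0 <= s by rewrite le_min invr_ge0 ler0n divr_ge0// ltW.
rewrite -ball_normE /ball_ /= opprD addrA subrr sub0r normrN normrZ ger0_norm//.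
apply: (@le_lt_trans _ _ (d / (`|w| + 1) * `|w|)).
  by rewrite ler_wpM2r// /s ge_min lexx orbT.
by rewrite mulrAC ltr_pdivrMr// mulrDr mulr1 ltrDl.
Qed.

(** Choose a point x of the edge, close to the interior vertex a i and hence in
    the domain. A short step from x across the edge ends in an element K' that
    also contains x. Both phi i and phi j are positive at x, so i and j are
    vertices of K', and the third vertex lies on the side of the step. *)
Lemma opposite_element i j k K : (i < Nvi)%N -> K \in T -> i != j -> k != i -> k != j ->
  K = [set i; j; k]%SET ->
  exists k' K', [/\ K' \in T, k' != i, k' != j, K' = [set i; j; k']%SET &
    cross (a j - a i) (a k' - a i) * cross (a j - a i) (a k - a i) < 0].
Proof.
move=> iN KT ij ki kj KE.
have iK : i \in K by rewrite KE !inE eqxx.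
have jK : j \in K by rewrite KE !inE eqxx orbT.
have kK : k \in K by rewrite KE !inE eqxx orbT.
set u := a j - a i; set v := a k - a i.
have e0 : cross u v != 0.
  have KE' : K = [set j; k; i]%SET by rewrite KE; apply/setP => l; rewrite !inE; do 3!case: (l == _).
  by apply: (element_cross_neq0 Hphi KT _ _ _ KE') => //; rewrite eq_sym.
have /nbhs_ballP[d /= d0 dO] : nbhs (a i) Omega.
  by apply: open_nbhs_nbhs; split=> //; exact: interior_vertex_Omega.
have [s /andP[s0 s1] /dO Ox] := @ball_step (a i) u d d0.
set x := a i + s *: u in Ox.
have [e e_gt0 near_x] := near_element Ox.
have [t /andP[t0 t1] /near_x[K' [K'T K'x K'y]]] := @ball_step x (- v) e e_gt0.
set y := x + t *: - v in K'y.
have Kx : hull K x.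
  by apply: hull_segment; rewrite ?(ltW s0) ?(ltW s1)//; exact: vertex_in_hull.
have phix l : phi l x = (l == i)%:R + s * ((l == j)%:R - (l == i)%:R).
  rewrite (phi_shift l KT (vertex_in_hull a iK) Kx) (phi_vertex Hphi).
  have -> : x - a i = s *: u by rewrite /x addrC addKr.
  by rewrite vecZ dotZr (grad_vertex Hphi).
have iK' : i \in K'.
  apply: (phi_pos_in K'T K'x); rewrite phix eqxx (negPf ij) mulr1n mulr0n; lra.
have jK' : j \in K'.
  by apply: (phi_pos_in K'T K'x); rewrite phix eqxx eq_sym (negPf ij) mulr1n mulr0n; lra.
have [k' [k'i k'j K'E]] := elementP Hmesh K'T iK' jK' ij.
exists k', K'; split=> //.
have k'K' : k' \in K' by rewrite K'E !inE eqxx orbT.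
have cy : cross u (y - a i) = - t * cross u v.
  by rewrite /y /x /cross /= /GRing.scale /=; ring.
have : cross u (y - a i) = phi k' y * cross u (a k' - a i).
  rewrite {1}(phi_comb Hphi K'T K'y) K'E (sum_set3 _ ij k'i k'j).
  have : phi i y = 1 - phi j y - phi k' y.
    have := phi_sum_in Hphi K'T K'y; rewrite K'E (sum_set3 _ ij k'i k'j); lra.
  by move=> ->; rewrite /u /cross /= /GRing.scale /=; ring.
rewrite cy => E; have := phi_ge0 Hphi k' K'T K'y; rewrite le_eqVlt => /predU1P[p0|p0].
  move/eqP: E; rewrite -p0 mul0r mulf_eq0 (negPf e0) oppr_eq0 orbF.
  by rewrite (gt_eqF t0).
rewrite -(pmulr_rlt0 _ p0) mulrA -E mulNr mulNr oppr_lt0 -mulrA mulr_gt0//.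
by rewrite -expr2 lt_def sqrf_eq0 e0 sqr_ge0.
Qed.

Lemma hull_comb3 i j k (al be ga : R) : i != j -> k != i -> k != j ->
  0 <= al -> 0 <= be -> 0 <= ga -> al + be + ga = 1 ->
  hull [set i; j; k]%SET (al *: a i + be *: a j + ga *: a k).
Proof.
move=> ij ki kj al0 be0 ga0 s1.
have ji : (j == i) = false by rewrite eq_sym; exact: negPf.
exists (fun l => if l == i then al else if l == j then be else ga).
by split; rewrite ?(sum_set3 _ ij ki kj) ?eqxx ?ji ?(negPf ki) ?(negPf kj) => // l _;
  do 2?case: ifP.
Qed.

(** Otherwise the two elements overlap near the midpoint of the edge, at a point
    where phi k is positive although k is not a vertex of K'. *)
Lemma same_side_eq i j k k' K K' : K \in T -> K' \in T -> i != j ->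
  k != i -> k != j -> k' != i -> k' != j ->
  K = [set i; j; k]%SET -> K' = [set i; j; k']%SET ->
  0 < cross (a j - a i) (a k' - a i) * cross (a j - a i) (a k - a i) -> k = k'.
Proof.
move=> KT K'T ij ki kj k'i k'j KE K'E.
set c' := cross _ (a k' - a i); set c := cross _ (a k - a i) => cc.
apply/eqP; apply: contraT => kk'.
have c'0 : c' != 0 by apply: contraTneq cc => ->; rewrite mul0r ltxx.
(* Affine coordinates of a k in the vertices of K'; the one of a k' is positive
   because k and k' are on the same side. *)
pose C := c / c'; pose B := cross (a k - a i) (a k' - a i) / c'; pose A := 1 - B - C.
have C0 : 0 < C.
  rewrite (_ : C = c' * c / c' ^+ 2); last by rewrite /C; field.
  by rewrite divr_gt0// exprn_even_gt0.
have akE : a k = A *: a i + B *: a j + C *: a k'.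
  rewrite /A /B /C; set b := cross (a k - a i) (a k' - a i).
  have key1 : c' * (a k).1 = (c' - b - c) * (a i).1 + b * (a j).1 + c * (a k').1.
    by rewrite /c' /b /c /cross /=; ring.
  have key2 : c' * (a k).2 = (c' - b - c) * (a i).2 + b * (a j).2 + c * (a k').2.
    by rewrite /c' /b /c /cross /=; ring.
  by apply: injective_projections; apply: (mulfI c'0); rewrite ?key1 ?key2 /= /GRing.scale /=; field.
(* The common point y below is a fraction t of the way from the midpoint of the
   edge to a k; this t is small enough for nonnegative coordinates in K'. *)
pose t := (1 + 2 * `|A| + 2 * `|B|)^-1.
have nA := normr_ge0 A; have nB := normr_ge0 B.
have den0 : 0 < 1 + 2 * `|A| + 2 * `|B| by lra.
have t0 : 0 < t by rewrite invr_gt0.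
have tE : t + 2 * (t * `|A|) + 2 * (t * `|B|) = 1.
  by rewrite -[RHS](mulVf (lt0r_neq0 den0)) -/t; ring.
have tA0 : 0 <= t * `|A| by rewrite mulr_ge0// ltW.
have tB0 : 0 <= t * `|B| by rewrite mulr_ge0// ltW.
have tA : - (t * `|A|) <= t * A by rewrite -mulrN ler_pM2l// lerNl -normrN ler_norm.
have tB : - (t * `|B|) <= t * B by rewrite -mulrN ler_pM2l// lerNl -normrN ler_norm.
pose h := (1 - t) / 2.
set y := h *: a i + h *: a j + t *: a k.
have Ky : hull K y by rewrite KE; apply: hull_comb3 => //; rewrite ?(ltW t0)// /h; lra.
have K'y : hull K' y.
  rewrite (_ : y = (h + t * A) *: a i + (h + t * B) *: a j + (t * C) *: a k').
    rewrite K'E; apply: hull_comb3 => //; rewrite /h.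
    - lra.
    - lra.
    - by rewrite mulr_ge0// ltW.
    - by rewrite /A; field.
  by rewrite /y akE; apply: injective_projections; rewrite /= /GRing.scale /=; ring.
have kK : k \in K by rewrite KE !inE eqxx orbT.
have : phi k y = t.
  rewrite (phi_shift k KT (vertex_in_hull a kK) Ky) (phi_vertex Hphi) eqxx.
  have iK : i \in K by rewrite KE !inE eqxx.
  have jK : j \in K by rewrite KE !inE eqxx orbT.
  rewrite (_ : y - a k = h *: (a i - a k) + h *: (a j - a k)); last first.
    by rewrite /y /h; apply: injective_projections; rewrite /= /GRing.scale /=; field.
  rewrite vecD !vecZ dotDr !dotZr !(grad_vertex Hphi)// eqxx (negPf ki) (negPf kj) /h.
  by rewrite mulr1n mulr0n; field.
rewrite (phi_notin Hphi K'T K'y) => [t00|]; first by rewrite -t00 ltxx in t0.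
by rewrite K'E !inE negb_or (negPf ki) (negPf kj) kk'.
Qed.
End MeshTopology.

(** * Angles in the metric of the diffusion matrix *)

Section Angles.
Variable R : realType.
Implicit Types (A : 'M[R]_2) (u v o p q : R * R) (x y : R).

Lemma arccot_cot x : 0 < x < pi -> arccot (cot x) = x.
Proof.
move=> /andP[x0 xpi]; rewrite /arccot /cot.
have -> : cos x / sin x = tan (pi / 2 - x).
  rewrite /tan (_ : pi / 2 - x = - (x - pi / 2)); last by ring.
  by rewrite sinN cosN sinBpihalf cosBpihalf opprK.
by rewrite tanK ?in_itv /=; [ring|apply/andP; split; lra].
Qed.

Lemma arccot_decr x y : x < y -> arccot y < arccot x.
Proof. by move=> xy; rewrite /arccot ltrD2l ltrN2; exact: lt_atan. Qed.

Lemma arccotN x : arccot (- x) = pi - arccot x.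
Proof. by rewrite /arccot atanN; field. Qed.

(** If the conclusion fails, then P' / P * cot al' - 2 * C / P is smaller than
    cot (pi - al), so that its arccot exceeds pi - al; likewise the other arccot
    exceeds pi - al'. The four angles then add up to more than 2 * pi. *)
Lemma angle_condition (P P' al al' C : R) : 0 < P -> 0 < P' -> 0 < al < pi -> 0 < al' < pi ->
  2^-1 * (al + al' + arccot (P' / P * cot al' - 2 * C / P)
    + arccot (P / P' * cot al - 2 * C / P')) <= pi ->
  2 * C <= P * cot al + P' * cot al'.
Proof.
move=> P0 P'0 al0 al'0 H; rewrite leNgt; apply/negP => lt.
have h1 : P' / P * cot al' - 2 * C / P < - cot al.
  rewrite -(ltr_pM2l P0) mulrN.
  by rewrite (_ : P * (_ - _) = P' * cot al' - 2 * C); [lra|field; rewrite gt_eqF].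
have h2 : P / P' * cot al - 2 * C / P' < - cot al'.
  rewrite -(ltr_pM2l P'0) mulrN.
  by rewrite (_ : P' * (_ - _) = P * cot al - 2 * C); [lra|field; rewrite gt_eqF].
move/arccot_decr : h1; move/arccot_decr : h2; rewrite !arccotN !arccot_cot//; lra.
Qed.

Lemma mulmx2E A (w : 'cV[R]_2) i : (A *m w) i 0 = A i 0 * w 0 0 + A i 1 * w 1 0.
Proof.
rewrite mxE big_ord_recl big_ord1.
by rewrite (_ : lift ord0 ord0 = 1)//; apply: val_inj.
Qed.

Lemma det2E A : \det A = A 0 0 * A 1 1 - A 0 1 * A 1 0.
Proof.
rewrite (expand_det_row _ 0) big_ord_recl big_ord1 /cofactor !det_mx11 !mxE /=.
have -> : lift ord0 ord0 = 1 :> 'I_2 by apply: val_inj.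
have -> : lift 1 0 = 0 :> 'I_2 by apply: val_inj.
by rewrite /bump /= expr0 expr1; ring.
Qed.

Lemma sym_posdef_sym A : sym_posdef A -> A 1 0 = A 0 1.
Proof. by move=> [AT _]; rewrite -[in LHS]AT mxE. Qed.

Lemma sym_posdef_det A : sym_posdef A -> 0 < \det A.
Proof.
move=> AP; have As := sym_posdef_sym AP; have [_ pos] := AP.
have vnz (x y : R) : (x != 0) || (y != 0) -> (vec (x, y) : 'cV[R]_2) != 0.
  apply: contraTneq => h; have := vec_0 (x, y); have := vec_1 (x, y).
  by rewrite h !mxE /= => <- <-; rewrite eqxx.
have A00 : 0 < A 0 0.
  have := pos _ (vnz 1 0 (_ : (1 != 0) || (0 != 0))); rewrite oner_neq0 => /(_ isT).
  by rewrite dotE !mulmx2E !vec_0 !vec_1 /=; lra.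
have := pos _ (vnz (- A 0 1) (A 0 0) (_ : (_ != 0) || (_ != 0))).
rewrite (lt0r_neq0 A00) orbT => /(_ isT).
rewrite dotE !mulmx2E !vec_0 !vec_1 /= det2E As => h.
rewrite -(pmulr_rgt0 _ A00); apply: (lt_le_trans h); rewrite le_eqVlt; apply/orP; left.
by apply/eqP; ring.
Qed.

Lemma invmx2_dot A (u v : 'cV[R]_2) : sym_posdef A ->
  dot u (invmx A *m v) = (A 1 1 * u 0 0 * v 0 0 - A 0 1 * (u 0 0 * v 1 0 + u 1 0 * v 0 0)
    + A 0 0 * u 1 0 * v 1 0) / \det A.
Proof.
move=> AP; have d0 := lt0r_neq0 (sym_posdef_det AP); have As := sym_posdef_sym AP.
have uA : A \in unitmx by rewrite unitmxE unitfE.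
set w := invmx A *m v; have Aw : A *m w = v by rewrite /w mulKVmx.
rewrite -Aw dotE !mulmx2E; apply: (mulIf d0); rewrite mulfVK// det2E As; ring.
Qed.

(** In the plane, gp and gq are the edge vectors v and u turned by a right angle
    and divided by the determinant. Turning by a right angle exchanges A with
    its adjugate, whence gp . A gq = - det A (u . A^-1 v) / (cross u v)^2, while
    the cotangent of the angle is (u . A^-1 v) sqrt (det A) / |cross u v|. *)
Lemma stiffness_cot A (o p q : R * R) (gp gq : 'cV[R]_2) :
  let u := p - o in let v := q - o in
  sym_posdef A -> cross u v != 0 ->
  dot gp (vec u) = 1 -> dot gp (vec v) = 0 -> dot gq (vec u) = 0 -> dot gq (vec v) = 1 ->
  let al := metric_angle (invmx A) o p q in
  0 < al < pi /\
  `|cross u v| / 2 * dot gp (A *m gq) = - (Num.sqrt (\det A) * cot al) / 2.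
Proof.
move=> u v AP e0 pu pv qu qv al.
have d0 := sym_posdef_det AP; have As := sym_posdef_sym AP.
set N := \det A in d0 *.
pose s := dot (vec u) (invmx A *m vec v).
pose P := dot (vec u) (invmx A *m vec u).
pose Q := dot (vec v) (invmx A *m vec v).
pose p0 := A 1 1 * u.1 * u.1 - A 0 1 * (u.1 * u.2 + u.2 * u.1) + A 0 0 * u.2 * u.2.
pose q0 := A 1 1 * v.1 * v.1 - A 0 1 * (v.1 * v.2 + v.2 * v.1) + A 0 0 * v.2 * v.2.
pose s0 := A 1 1 * u.1 * v.1 - A 0 1 * (u.1 * v.2 + u.2 * v.1) + A 0 0 * u.2 * v.2.
have PE : P = p0 / N by rewrite /P invmx2_dot// !vec_0 !vec_1.
have QE : Q = q0 / N by rewrite /Q invmx2_dot// !vec_0 !vec_1.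
have sE : s = s0 / N by rewrite /s invmx2_dot// !vec_0 !vec_1.
have key : p0 * q0 - s0 ^+ 2 = N * cross u v ^+ 2.
  by rewrite /N det2E As /p0 /q0 /s0 /cross; ring.
(* The Gram determinant of u and v in the inverse metric gives the sine. *)
have PQ : P * Q - s ^+ 2 = cross u v ^+ 2 / N.
  transitivity ((p0 * q0 - s0 ^+ 2) / N ^+ 2); first by rewrite PE QE sE; field; rewrite gt_eqF.
  by rewrite key; field; rewrite gt_eqF.
have ev0 : 0 < cross u v ^+ 2 by rewrite exprn_even_gt0.
have PQ0 : 0 < P * Q - s ^+ 2 by rewrite PQ divr_gt0.
have A00 : 0 < A 0 0.
  have := AP.2 (vec (1, 0)); rewrite dotE !mulmx2E !vec_0 !vec_1 /= => h.
  have : (vec (1, 0) : 'cV[R]_2) != 0.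
    by apply: contraTneq isT => h0; have := vec_0 ((1, 0) : R * R); rewrite h0 mxE => /esym/eqP;
      rewrite oner_eq0.
  by move/h; lra.
have pos (x y : R) : 0 <= (A 1 1 * x * x - A 0 1 * (x * y + y * x) + A 0 0 * y * y) / N.
  apply: divr_ge0; last exact: ltW.
  rewrite -(pmulr_rge0 _ A00).
  have -> : A 0 0 * (A 1 1 * x * x - A 0 1 * (x * y + y * x) + A 0 0 * y * y) =
      (A 0 0 * y - A 0 1 * x) ^+ 2 + N * x ^+ 2 by rewrite /N det2E As; ring.
  by rewrite addr_ge0 ?sqr_ge0// mulr_ge0 ?sqr_ge0// ltW.
have P0 : 0 <= P by rewrite PE; exact: pos.
have Q0 : 0 <= Q by rewrite QE; exact: pos.
have PQgt0 : 0 < P * Q by have := sqr_ge0 s; lra.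
pose X := Num.sqrt P * Num.sqrt Q.
have X2 : X ^+ 2 = P * Q by rewrite exprMn !sqr_sqrtr.
have X0 : 0 < X.
  by rewrite lt_def mulr_ge0 ?sqrtr_ge0// andbT -sqrf_eq0 X2 gt_eqF.
pose y := s / X; have alE : al = acos y by [].
have y2 : 1 - y ^+ 2 = cross u v ^+ 2 / N / X ^+ 2.
  rewrite -PQ -X2 /y; field; rewrite gt_eqF//.
have y2lt : 0 < 1 - y ^+ 2 by rewrite y2 !divr_gt0// exprn_gt0.
have yy : -1 < y < 1.
  by rewrite -ltr_norml -(@ltr_pXn2r _ 2%N)// ?nnegrE// real_normK ?num_real// expr1n; lra.
have /andP[y1 y1'] := yy.
split; first by rewrite alE acos_gt0 ?acos_ltpi// ?(ltW y1) ?(ltW y1') ?y1 ?y1'.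
have N2 : Num.sqrt N * Num.sqrt N = N by rewrite -expr2 sqr_sqrtr// ltW.
have e2 : cross u v ^+ 2 = `|cross u v| ^+ 2 by rewrite real_normK ?num_real.
have n0 : 0 < `|cross u v| by rewrite normr_gt0.
have sN0 : 0 < Num.sqrt N by rewrite sqrtr_gt0.
have cotE : cot al = s * Num.sqrt N / `|cross u v|.
  rewrite /cot alE acosK ?in_itv/= ?(ltW y1) ?(ltW y1')// sin_acos ?(ltW y1) ?(ltW y1')//.
  have -> : 1 - y ^+ 2 = (`|cross u v| / (Num.sqrt N * X)) ^+ 2.
    have aux (x n z : R) : n != 0 -> z != 0 -> (x / (n * z)) ^+ 2 = x ^+ 2 / (n * n) / z ^+ 2.
      by move=> n_neq0 z_neq0; field; rewrite n_neq0 z_neq0.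
    by rewrite [RHS]aux ?lt0r_neq0// N2 y2 e2.
  have ge0 : 0 <= `|cross u v| / (Num.sqrt N * X).
    by rewrite divr_ge0// ltW// mulr_gt0.
  have aux (r x n z : R) : x != 0 -> n != 0 -> z != 0 -> r / z / (x / (n * z)) = r * n / x.
    by move=> x_neq0 n_neq0 z_neq0; field; rewrite x_neq0 n_neq0 z_neq0.
  by rewrite sqrtr_sqr (ger0_norm ge0) aux ?lt0r_neq0.
have stiff : cross u v ^+ 2 * dot gp (A *m gq) = - s0.
  move: pu pv qu qv; rewrite !dot_vec => pu pv qu qv.
  have gp0 : gp 0 0 * cross u v = v.2.
    transitivity ((gp 0 0 * u.1 + gp 1 0 * u.2) * v.2 - (gp 0 0 * v.1 + gp 1 0 * v.2) * u.2).
      by rewrite /cross; ring.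
    by rewrite pu pv; ring.
  have gp1 : gp 1 0 * cross u v = - v.1.
    transitivity ((gp 0 0 * v.1 + gp 1 0 * v.2) * u.1 - (gp 0 0 * u.1 + gp 1 0 * u.2) * v.1).
      by rewrite /cross; ring.
    by rewrite pu pv; ring.
  have gq0 : gq 0 0 * cross u v = - u.2.
    transitivity ((gq 0 0 * u.1 + gq 1 0 * u.2) * v.2 - (gq 0 0 * v.1 + gq 1 0 * v.2) * u.2).
      by rewrite /cross; ring.
    by rewrite qu qv; ring.
  have gq1 : gq 1 0 * cross u v = u.1.
    transitivity ((gq 0 0 * v.1 + gq 1 0 * v.2) * u.1 - (gq 0 0 * u.1 + gq 1 0 * u.2) * v.1).
      by rewrite /cross; ring.
    by rewrite qu qv; ring.
  transitivity (A 0 0 * (gp 0 0 * cross u v) * (gq 0 0 * cross u v)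
    + A 0 1 * ((gp 0 0 * cross u v) * (gq 1 0 * cross u v) + (gp 1 0 * cross u v) * (gq 0 0 * cross u v))
    + A 1 1 * (gp 1 0 * cross u v) * (gq 1 0 * cross u v)).
    by rewrite dotE !mulmx2E As; ring.
  by rewrite gp0 gp1 gq0 gq1 /s0; ring.
have -> : dot gp (A *m gq) = - s0 / `|cross u v| ^+ 2.
  by rewrite -stiff e2; field; rewrite gt_eqF.
rewrite cotE sE -[N in s0 / N]N2; field.
by rewrite !gt_eqF ?sqrtr_gt0.
Qed.
End Angles.

(** * Integrals over an element *)

Section Elements.
Variables (R : realType) (Omega : set (R * R)) (Nvi Nv : nat) (a : 'I_Nv -> R * R).
Variables (T : {set {set 'I_Nv}}) (phi : 'I_Nv -> R * R -> R).
Variables (D : R * R -> 'M[R]_2) (b : R * R -> 'cV[R]_2) (c f g : R * R -> R).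
Hypothesis Hmesh : conforming_mesh Omega Nvi a T.
Hypothesis Hphi : nodal_basis Omega a T phi.
Hypothesis Hdata : bvp_data Omega D b c f g.
Implicit Types (K : {set 'I_Nv}) (x y : R * R) (i j k l : 'I_Nv).

Notation hull := (conv_hull a).
Notation cont K h := {within conv_hull a K, continuous h}.

Lemma closure_ge0 (h : R * R -> R) : continuous_upto_boundary Omega h ->
  (forall x, Omega x -> 0 <= h x) -> forall x, closure Omega x -> 0 <= h x.
Proof.
move=> ch h0 x Ox; rewrite leNgt; apply/negP => hx.
have cx : h @ within (closure Omega) (nbhs x) --> h x.
  by move: ch => /subspace_continuousP; apply.
have hx2 : 0 < - h x by rewrite oppr_gt0.
have : \forall y \near within (closure Omega) (nbhs x), `|h x - h y| < - h x.
  by move/cvgrPdist_lt : cx; apply.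
rewrite near_withinE => /Ox [y [Oy /(_ (subset_closure Oy))]].
by rewrite ltr_norml => /andP[]; have := h0 _ Oy; lra.
Qed.

Lemma hull_is_triangle K : K \in T -> exists o u v, cross u v != 0 /\ hull K = triangle o u v.
Proof.
move=> KT; have [i [j [k [ij ki kj KE]]]] := element_vertices Hmesh KT.
exists (a k), (a i - a k), (a j - a k).
by rewrite (hull_triangle a ij ki kj KE) (element_cross_neq0 Hphi KT ij ki kj KE).
Qed.

Lemma within_hull K (h : R * R -> R) : K \in T -> continuous_upto_boundary Omega h -> cont K h.
Proof. by move=> KT; apply: continuous_subspaceW; exact: (hull_sub Hmesh KT). Qed.

Lemma within_phi K l : K \in T -> cont K (phi l).
Proof. by move=> KT; apply: within_hull => //; have [] := Hphi l. Qed.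

Lemma within_D K s t : K \in T -> cont K (fun x => D x s t).
Proof. by move=> KT; apply: within_hull => //; have [] := bvp_D_smooth Hdata s t. Qed.

Lemma within_b K s : K \in T -> cont K (fun x => b x s 0).
Proof. by move=> KT; apply: within_hull => //; have [] := bvp_b_smooth Hdata s. Qed.

Lemma within_c K : K \in T -> cont K c.
Proof. by move=> KT; apply: within_hull => //; exact: (bvp_c_smooth Hdata). Qed.

Lemma within_dot_b K q : K \in T -> cont K (fun x => dot (b x) q).
Proof.
move=> KT; rewrite (_ : (fun x => _) = fun x => b x 0 0 * q 0 0 + b x 1 0 * q 1 0).
  by apply: within_add; apply: within_mul; rewrite ?within_cst//; try exact: within_b; exact: within_cst.
by apply/funext => x; rewrite dotE.
Qed.

Lemma element_integralD K (h1 h2 : R * R -> R) : K \in T -> cont K h1 -> cont K h2 ->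
  integral2 (hull K) (fun x => h1 x + h2 x) = integral2 (hull K) h1 + integral2 (hull K) h2.
Proof. by move=> /hull_is_triangle[p [u [v [e0 ->]]]]; exact: integral2D. Qed.

Lemma element_integralZ K r (h : R * R -> R) : K \in T -> cont K h ->
  integral2 (hull K) (fun x => r * h x) = r * integral2 (hull K) h.
Proof. by move=> /hull_is_triangle[p [u [v [e0 ->]]]]; exact: integral2Z. Qed.

Lemma element_integral_eq0 K (h : R * R -> R) : K \in T -> cont K h ->
  (forall x, hull K x -> 0 <= h x) ->
  integral2 (hull K) h = 0 -> forall x, hull K x -> h x = 0.
Proof.
move=> /hull_is_triangle[p [u [v [e0 ->]]]] ch h0 ih x Kx.
apply/eqP; rewrite eq_le h0// andbT leNgt; apply/negP => hx.
by have := integral2_gt0 e0 ch h0 Kx hx; rewrite ih ltxx.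
Qed.

Lemma element_integral_sum K (I : finType) (h : I -> R * R -> R) :
  K \in T -> (forall s, cont K (h s)) ->
  integral2 (hull K) (fun x => \sum_s h s x) = \sum_s integral2 (hull K) (h s).
Proof.
move=> KT ch.
have H (r : seq I) : cont K (fun x => \sum_(s <- r) h s x) /\
  integral2 (hull K) (fun x => \sum_(s <- r) h s x) = \sum_(s <- r) integral2 (hull K) (h s).
  elim: r => [|s r [IH1 IH2]].
    under eq_fun do rewrite big_nil; rewrite big_nil; split; first exact: within_cst.
    transitivity (0 * integral2 (hull K) (fun=> 0)); last by rewrite mul0r.
    by rewrite -(element_integralZ _ KT); [apply: eq_integral2 => x _; rewrite mul0r|exact: within_cst].
  under eq_fun do rewrite big_cons; rewrite big_cons; split; first exact: within_add.
  by rewrite element_integralD// IH2.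
by have [] := H (index_enum I).
Qed.

Lemma area_gt0 K : K \in T -> 0 < area (hull K).
Proof.
by move=> /hull_is_triangle[p [u [v [e0 ->]]]]; rewrite triangle_area// divr_gt0// normr_gt0.
Qed.

Lemma hull_bounded K (h : R * R -> R) : K \in T -> cont K h ->
  exists M, forall x, hull K x -> `|h x| <= M.
Proof.
move=> /hull_is_triangle[p [u [v [e0 ->]]]] ch.
have [M [_ hM]] := compact_bounded (continuous_compact ch (@triangle_compact _ p u v)).
by exists (M + 1) => x Kx; apply: (hM (M + 1)); [rewrite ltrDl|exists x].
Qed.

Lemma closure_sym x : closure Omega x -> D x 1 0 = D x 0 1.
Proof.
move=> Ox.
have [c10 _ _] := bvp_D_smooth Hdata 1 0; have [c01 _ _] := bvp_D_smooth Hdata 0 1.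
have cB s t s' t' : continuous_upto_boundary Omega (fun x => D x s t - D x s' t').
  have [c1 _ _] := bvp_D_smooth Hdata s t; have [c2 _ _] := bvp_D_smooth Hdata s' t'.
  by move=> z; apply: cvgB; [exact: c1|exact: c2].
have h s t s' t' : (forall x, Omega x -> D x s t = D x s' t') -> 0 <= D x s t - D x s' t'.
  by move=> hh; apply: (closure_ge0 (cB s t s' t')) => // z Oz; rewrite hh// subrr.
have hs z : Omega z -> D z 1 0 = D z 0 1.
  by move=> /(bvp_D_posdef Hdata)/sym_posdef_sym.
by apply/eqP; rewrite eq_le; apply/andP; split; rewrite -subr_ge0; apply: h => z Oz; rewrite hs.
Qed.

Definition diffusion_form (w : 'cV[R]_2) x := dot w (D x *m w).

Lemma diffusion_formE w : diffusion_form w = fun x => w 0 0 * w 0 0 * D x 0 0 +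
  (w 0 0 * w 1 0 * D x 0 1 + (w 1 0 * w 0 0 * D x 1 0 + w 1 0 * w 1 0 * D x 1 1)).
Proof. by apply/funext => x; rewrite /diffusion_form dotE !mulmx2E; ring. Qed.

Lemma within_diffusion_form w : continuous_upto_boundary Omega (diffusion_form w).
Proof.
have cZ r s t : continuous_upto_boundary Omega (fun x => r * D x s t).
  have [c1 _ _] := bvp_D_smooth Hdata s t.
  by move=> z; apply: cvgM; [exact: cvg_cst|exact: c1].
rewrite diffusion_formE => z; apply: cvgD; first exact: cZ.
apply: cvgD; first exact: cZ.
by apply: cvgD; exact: cZ.
Qed.

Lemma area_avg_mx_form K w : K \in T ->
  area (hull K) * dot w (avg_mx (hull K) D *m w) = integral2 (hull K) (diffusion_form w).
Proof.
move=> KT; have A0 := lt0r_neq0 (area_gt0 KT); rewrite diffusion_formE.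
have cZ r s t : cont K (fun x => r * D x s t).
  by apply: within_mul; [exact: within_cst|exact: within_D].
rewrite (element_integralD KT (cZ _ _ _) (within_add (cZ _ _ _) (within_add (cZ _ _ _) (cZ _ _ _)))).
rewrite (element_integralD KT (cZ _ _ _) (within_add (cZ _ _ _) (cZ _ _ _))).
rewrite element_integralD// !element_integralZ//; try exact: within_D.
by rewrite dotE !mulmx2E !mxE; field.
Qed.

(** The integrand of the quadratic form is nonnegative on the element by
    continuity, and positive at its interior points, which belong to the domain. *)
Lemma avg_mx_posdef K : K \in T -> sym_posdef (avg_mx (hull K) D).
Proof.
move=> KT; split.
  apply/matrixP => s t; rewrite !mxE; congr (_ * _); apply: eq_integral2 => x Kx.
  have Ds := closure_sym (hull_sub Hmesh KT Kx).
  have I2 (r : 'I_2) : r = 0 \/ r = 1.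
    by case: r => -[|[|//]] hr; [left|right]; apply: val_inj.
  by case: (I2 s) => ->; case: (I2 t) => ->.
move=> w w0; rewrite -(pmulr_rgt0 _ (area_gt0 KT)) (area_avg_mx_form w KT).
have Dge0 y : hull K y -> 0 <= diffusion_form w y.
  move=> Ky; have Oy := hull_sub Hmesh KT Ky; move: y Oy {Ky}.
  apply: (closure_ge0 (@within_diffusion_form w)) => z Oz.
  by apply: ltW; exact: (bvp_D_posdef Hdata Oz).2.
have cDw : cont K (diffusion_form w) by apply: (within_hull KT); exact: (@within_diffusion_form w).
rewrite lt_def integral2_ge0// andbT; apply/eqP => /(element_integral_eq0 KT cDw Dge0) Dw0.
have [x Kx] := mesh_nondegenerate Hmesh KT.
have := (bvp_D_posdef Hdata (mesh_inside Hmesh KT Kx)).2 w w0.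
by rewrite -/(diffusion_form w x) Dw0 ?ltxx//; exact: interior_subset.
Qed.

End Elements.

(** * Element contributions to the stiffness matrix *)

Section Entries.
Variables (R : realType) (Omega : set (R * R)) (Nvi Nv : nat) (a : 'I_Nv -> R * R).
Variables (T : {set {set 'I_Nv}}) (phi : 'I_Nv -> R * R -> R).
Variables (D : R * R -> 'M[R]_2) (b : R * R -> 'cV[R]_2) (c f g : R * R -> R).
Hypothesis Hmesh : conforming_mesh Omega Nvi a T.
Hypothesis Hphi : nodal_basis Omega a T phi.
Hypothesis Hdata : bvp_data Omega D b c f g.
Implicit Types (K : {set 'I_Nv}) (x y : R * R) (i j k l : 'I_Nv).

Notation line := (measurableTypeR R).
Notation hull := (conv_hull a).
Notation grad K j := (grad_on (conv_hull a K) (phi j)).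
Notation cont K h := {within conv_hull a K, continuous h}.

Lemma grad_neq0 K i j : K \in T -> i \in K -> j \in K -> i != j -> grad K j != 0.
Proof.
move=> KT iK jK ij; apply: contraTneq isT => g0.
have := grad_vertex Hphi j KT jK iK; rewrite g0 dot0l eqxx eq_sym (negPf ij) => /eqP.
by rewrite mulr1n mulr0n subr0 eq_sym oner_eq0.
Qed.

(** The affine extension of phi j drops from 1 to 0 between a j and each point of the
    opposite line, which bounds the distance from below by Cauchy-Schwarz;
    equality holds at the foot of the altitude. *)
Lemma height_grad K i j : K \in T -> i \in K -> j \in K -> i != j ->
  height a K j = (enorm (grad K j))^-1.
Proof.
move=> KT iK jK ij; have [k [ki kj KE]] := elementP Hmesh KT iK jK ij.
have kK : k \in K by rewrite KE !inE eqxx orbT.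
have q0 := grad_neq0 KT iK jK ij.
set q := grad K j in q0 *.
have n0 : 0 < enorm q by rewrite lt_def enorm_eq0 q0 enorm_ge0.
have KjE : (K :\ j)%SET = [set i; k]%SET.
  apply/setP => l; rewrite KE !inE; have [->|lj] /= := eqVneq l j; last by rewrite orbF.
  by rewrite eq_sym (negPf ij) eq_sym (negPf kj).
have dji : dot q (vec (a j - a i)) = 1.
  by rewrite (grad_vertex Hphi)// eqxx eq_sym (negPf ij) subr0.
have djk : dot q (vec (a j - a k)) = 1.
  by rewrite (grad_vertex Hphi)// eqxx eq_sym (negPf kj) subr0.
have sum2 (V : nmodType) (F : 'I_Nv -> V) : \sum_(l in [set i; k]%SET) F l = F i + F k.
  by rewrite big_setU1 ?inE 1?eq_sym// big_set1.
rewrite /height KjE; set S := [set _ | _ in _].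
have lb : lbound S (enorm q)^-1.
  move=> _ [y [w w1 ->] <-]; rewrite !sum2 in w1 *.
  have : 1 = dot q (vec (a j - (w i *: a i + w k *: a k))).
    move: dji djk; rewrite !dot_vec /= /GRing.scale /= => dji djk.
    have -> : w k = 1 - w i by rewrite -w1; ring.
    transitivity (w i * (q 0 0 * ((a j).1 - (a i).1) + q 1 0 * ((a j).2 - (a i).2)) +
      (1 - w i) * (q 0 0 * ((a j).1 - (a k).1) + q 1 0 * ((a j).2 - (a k).2))); last by ring.
    by rewrite dji djk; ring.
  move=> E; rewrite -[_^-1]mul1r ler_pdivrMr// E (le_trans (cauchy_schwarz _ _))//.
  by rewrite mulrC.
(* The foot of the altitude from a j. *)
pose y0 : R * R := a j - (enorm q ^- 2 * q 0 0, enorm q ^- 2 * q 1 0).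
have n2 : enorm q ^+ 2 = q 0 0 ^+ 2 + q 1 0 ^+ 2 by rewrite enorm_sqr dotE; ring.
have Sy0 : S (enorm q)^-1.
  exists y0; last first.
    have -> : eucl_dist (a j) y0 = enorm (enorm q ^- 2 *: q).
      rewrite /eucl_dist; congr enorm; apply: cV2P; rewrite !mxE /= /y0 /=; ring.
    rewrite /enorm dotZl dotZr -/(enorm q) -enorm_sqr.
    rewrite (_ : _ * _ = (enorm q)^-1 ^+ 2); last by field; rewrite gt_eqF.
    by rewrite sqrtr_sqr ger0_norm// invr_ge0 ltW.
  set u := a i - a k.
  have uq : dot q (vec u) = 0.
    by rewrite (grad_vertex Hphi)// eq_sym (negPf ij) eq_sym (negPf kj) subr0.
  have uu : 0 < u.1 ^+ 2 + u.2 ^+ 2.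
    rewrite lt_def addr_ge0 ?sqr_ge0// andbT paddr_eq0 ?sqr_ge0// !sqrf_eq0.
    apply/negP => /andP[/eqP u1 /eqP u2].
    have : dot (grad K i) (vec u) = 1.
      by rewrite (grad_vertex Hphi)// eqxx eq_sym (negPf ki) subr0.
    by rewrite dot_vec u1 u2 !mulr0 addr0 => /eqP; rewrite eq_sym oner_eq0.
  pose s := ((y0 - a k).1 * u.1 + (y0 - a k).2 * u.2) / (u.1 ^+ 2 + u.2 ^+ 2).
  exists (fun l => if l == i then s else 1 - s).
    by rewrite sum2 eqxx (negPf ki); ring.
  rewrite sum2 eqxx (negPf ki).
  set z := y0 - a k in s *.
  have qz : dot q (vec z) = 0.
    rewrite (_ : z = (a j - a k) - (enorm q ^- 2 * q 0 0, enorm q ^- 2 * q 1 0)).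
      rewrite dot_vecB djk dot_vec /=; apply/eqP; rewrite subr_eq0 eq_sym; apply/eqP.
      transitivity (enorm q ^- 2 * (q 0 0 ^+ 2 + q 1 0 ^+ 2)); first by ring.
      by rewrite -n2 mulVf// lt0r_neq0// exprn_gt0.
    by rewrite /z /y0; apply: injective_projections; rewrite /=; ring.
  have cz : cross z u = 0.
    move: qz uq; rewrite !dot_vec => qz uq; apply: (mulfI (lt0r_neq0 (exprn_gt0 2 n0))).
    rewrite n2 mulr0 /cross.
    transitivity (q 0 0 * ((q 0 0 * z.1 + q 1 0 * z.2) * u.2 - z.2 * (q 0 0 * u.1 + q 1 0 * u.2))
      + q 1 0 * (z.1 * (q 0 0 * u.1 + q 1 0 * u.2) - u.1 * (q 0 0 * z.1 + q 1 0 * z.2))); first by ring.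
    by rewrite qz uq; ring.
  have W0 := lt0r_neq0 uu.
  have z1 : z.1 = s * u.1.
    transitivity ((z.1 * (u.1 ^+ 2 + u.2 ^+ 2)) / (u.1 ^+ 2 + u.2 ^+ 2)); first by rewrite mulfK.
    rewrite (_ : z.1 * _ = (z.1 * u.1 + z.2 * u.2) * u.1 + u.2 * cross z u).
      by rewrite cz mulr0 addr0 /s mulrAC.
    by rewrite /cross; ring.
  have z2 : z.2 = s * u.2.
    transitivity ((z.2 * (u.1 ^+ 2 + u.2 ^+ 2)) / (u.1 ^+ 2 + u.2 ^+ 2)); first by rewrite mulfK.
    rewrite (_ : z.2 * _ = (z.1 * u.1 + z.2 * u.2) * u.2 - u.1 * cross z u).
      by rewrite cz mulr0 subr0 /s mulrAC.
    by rewrite /cross; ring.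
  have zE : z = s *: u by apply: injective_projections; [exact: z1|exact: z2].
  transitivity (a k + z); first by rewrite /z addrC subrK.
  transitivity (a k + s *: u); first by rewrite -zE.
  by apply: injective_projections; rewrite /u /= /GRing.scale /=; ring.
apply: le_anti; apply/andP; split.
  by apply: ge_inf => //; exists (enorm q)^-1.
by apply: lb_le_inf => //; exists (enorm q)^-1.
Qed.

(** The nodal functions are controlled on the elements only, and the change of
    variables asks for a function that is measurable on the whole plane. *)
Lemma phi_extension K i j k l : K \in T -> i \in K -> j \in K -> k \in K ->
  exists h : R * R -> R, [/\ measurable_fun [set: line * line] (h : _ -> line),
    forall x, hull K x -> phi l x = h x &
    forall z, h (affine_map (a k) (a i - a k) (a j - a k) z) =
      (l == k)%:R + z.1 * ((l == i)%:R - (l == k)%:R) + z.2 * ((l == j)%:R - (l == k)%:R)].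
Proof.
move=> KT iK jK kK; have [m hm] := phi_gradient Hphi l KT.
set q := grad K l in hm *.
exists (fun x => dot q (vec x) + m); split=> //.
  under eq_fun do rewrite dot_vec.
  by apply: measurable_funD => //; apply: measurable_funD; apply: measurable_funM.
move=> z; rewrite /affine_map !vecD !vecZ !dotDr !dotZr !(grad_vertex Hphi)//.
have := hm _ (vertex_in_hull a kK); rewrite (phi_vertex Hphi) => ->; ring.
Qed.

Lemma phi_integral K i j : K \in T -> i \in K -> j \in K -> i != j ->
  integral2 (hull K) (phi i) = area (hull K) / 3.
Proof.
move=> KT iK jK ij; have [k [ki kj KE]] := elementP Hmesh KT iK jK ij.
have kK : k \in K by rewrite KE !inE eqxx orbT.
have [h [mh hE hz]] := phi_extension i KT iK jK kK.
rewrite (eq_integral2 hE) (hull_triangle a ij ki kj KE).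
apply: triangle_integral_bary => //; first exact: (element_cross_neq0 Hphi KT ij ki kj KE).
by move=> z; rewrite hz eqxx (negPf ij) eq_sym (negPf ki) mulr1n mulr0n; ring.
Qed.

Lemma phi2_integral K i j : K \in T -> i \in K -> j \in K -> i != j ->
  integral2 (hull K) (fun x => phi i x * phi j x) = area (hull K) / 12.
Proof.
move=> KT iK jK ij; have [k [ki kj KE]] := elementP Hmesh KT iK jK ij.
have kK : k \in K by rewrite KE !inE eqxx orbT.
have [h [mh hE hz]] := phi_extension i KT iK jK kK.
have [h' [mh' hE' hz']] := phi_extension j KT iK jK kK.
rewrite (@eq_integral2 _ _ _ (fun x => h x * h' x)); last by move=> x Kx; rewrite hE// hE'.
rewrite (hull_triangle a ij ki kj KE).
apply: triangle_integral_bary2 => //; first exact: (element_cross_neq0 Hphi KT ij ki kj KE).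
  exact: measurable_funM.
move=> z; rewrite hz hz' !eqxx (negPf ij) (eq_sym i k) (negPf ki) (eq_sym j i) (negPf ij).
by rewrite (eq_sym j k) (negPf kj) mulr1n mulr0n; ring.
Qed.

(** The bilinear form of the scheme on one element, for the test function phi i
    and the trial function phi j. *)
Definition element_entry K i j : R :=
  area (hull K) * dot (grad K i) (avg_mx (hull K) D *m grad K j)
  + integral2 (hull K) (fun x => phi i x * dot (b x) (grad K j))
  + integral2 (hull K) (fun x => c x * phi j x * phi i x).

Definition bsup K := sup [set enorm (b x) | x in hull K].
Definition csup K := sup [set c x | x in hull K].

(** The amount by which the convection and reaction terms stay below C_elem.
    Keeping it, instead of only its sign, is what later identifies b on elements
    where the bound is attained. *)
Definition slack K i j : R :=
  integral2 (hull K) (fun x => phi i x * (bsup K * enorm (grad K j) - dot (b x) (grad K j)))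
  + integral2 (hull K) (fun x => (csup K - c x) * (phi i x * phi j x)).

Lemma b_le_bsup K x : K \in T -> hull K x -> enorm (b x) <= bsup K.
Proof.
move=> KT Kx; apply: ub_le_sup; last by exists x.
have [M0 hM0] := hull_bounded Hmesh Hphi KT (within_b Hmesh Hdata (s := 0) KT).
have [M1 hM1] := hull_bounded Hmesh Hphi KT (within_b Hmesh Hdata (s := 1) KT).
exists (M0 + M1) => _ [y Ky <-]; have h0 := hM0 y Ky; have h1 := hM1 y Ky.
have := normr_ge0 (b y 0 0); have := normr_ge0 (b y 1 0) => n1 n0.
rewrite -(@ler_pXn2r _ 2%N)// ?nnegrE ?enorm_ge0//; last lra.
rewrite enorm_sqr dotE -[X in X + _ <= _]expr2 -[X in _ + X <= _]expr2.
rewrite -(real_normK (num_real (b y 0 0))) -(real_normK (num_real (b y 1 0))); nra.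
Qed.

Lemma c_le_csup K x : K \in T -> hull K x -> c x <= csup K.
Proof.
move=> KT Kx; apply: ub_le_sup; last by exists x.
have [M hM] := hull_bounded Hmesh Hphi KT (within_c Hmesh Hdata KT).
by exists M => _ [y Ky <-]; rewrite (le_trans (ler_norm _))// hM.
Qed.

Lemma bdot_le K j x : K \in T -> hull K x -> dot (b x) (grad K j) <= bsup K * enorm (grad K j).
Proof.
move=> KT Kx; rewrite (le_trans (cauchy_schwarz _ _))// ler_wpM2r ?enorm_ge0//.
exact: b_le_bsup.
Qed.

Lemma within_convection_slack K i j : K \in T ->
  cont K (fun x => phi i x * (bsup K * enorm (grad K j) - dot (b x) (grad K j))).
Proof.
move=> KT; apply: within_mul; first exact: (within_phi Hmesh Hphi).
by apply: within_sub; [exact: within_cst|exact: (within_dot_b Hmesh Hdata)].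
Qed.

Lemma convection_slack_ge0 K i j x : K \in T -> hull K x ->
  0 <= phi i x * (bsup K * enorm (grad K j) - dot (b x) (grad K j)).
Proof.
by move=> KT Kx; rewrite mulr_ge0 ?(phi_ge0 Hphi i KT Kx)// subr_ge0 bdot_le.
Qed.

Lemma reaction_slack_ge0 K i j x : K \in T -> hull K x -> 0 <= (csup K - c x) * (phi i x * phi j x).
Proof.
move=> KT Kx; rewrite mulr_ge0 ?subr_ge0 ?c_le_csup// mulr_ge0//.
  exact: (phi_ge0 Hphi i KT Kx).
exact: (phi_ge0 Hphi j KT Kx).
Qed.

Lemma slack_ge0 K i j : K \in T -> 0 <= slack K i j.
Proof.
by move=> KT; rewrite addr_ge0//; apply: integral2_ge0 => x Kx;
  [exact: convection_slack_ge0|exact: reaction_slack_ge0].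
Qed.

(** Two integrals of nonnegative continuous functions that add up to 0 both
    vanish, and so does the first integrand. *)
Lemma slack_eq0 K i j x : K \in T -> slack K i j = 0 -> hull K x -> 0 < phi i x ->
  dot (b x) (grad K j) = bsup K * enorm (grad K j).
Proof.
move=> KT; rewrite /slack; set I1 := integral2 _ _; set I2 := integral2 _ _ => /eqP.
have I1_ge0 : 0 <= I1 by apply: integral2_ge0 => y Ky; exact: convection_slack_ge0.
have I2_ge0 : 0 <= I2 by apply: integral2_ge0 => y Ky; exact: reaction_slack_ge0.
rewrite paddr_eq0// => /andP[/eqP I10 _] Kx p0.
have := element_integral_eq0 Hmesh Hphi KT (@within_convection_slack K i j KT)
  (fun y Ky => convection_slack_ge0 i j KT Ky) I10 Kx.
by move/eqP; rewrite mulf_eq0 (gt_eqF p0) subr_eq0 => /eqP.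
Qed.

(** The denominators 3 and 12 in C_elem come from the integrals of phi i and of
    phi i * phi j, and the height turns into the norm of the gradient. *)
Lemma element_entryE K i j : K \in T -> i \in K -> j \in K -> i != j ->
  element_entry K i j = area (hull K) * dot (grad K i) (avg_mx (hull K) D *m grad K j)
    + C_elem 2 a b c K j - slack K i j.
Proof.
move=> KT iK jK ij; rewrite /element_entry /slack /C_elem -/(bsup K) -/(csup K).
rewrite (height_grad KT iK jK ij).
have cp l : cont K (phi l) by exact: (within_phi Hmesh Hphi).
have cb : cont K (fun x => phi i x * dot (b x) (grad K j)).
  by apply: within_mul => //; exact: (within_dot_b Hmesh Hdata).
have cc : cont K (fun x => c x * phi j x * phi i x).
  by apply: within_mul => //; apply: within_mul => //; exact: (within_c Hmesh Hdata).
have cpp : cont K (fun x => phi i x * phi j x) by exact: within_mul.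
set be := bsup K * enorm (grad K j).
have -> : integral2 (hull K) (fun x => phi i x * (be - dot (b x) (grad K j))) =
    be * (area (hull K) / 3) - integral2 (hull K) (fun x => phi i x * dot (b x) (grad K j)).
  rewrite -(phi_integral KT iK jK ij) -(element_integralZ Hmesh Hphi be KT (cp i)).
  rewrite -[X in _ - X]mul1r -mulNr.
  rewrite -(element_integralZ Hmesh Hphi _ KT cb) -(element_integralD Hmesh Hphi KT).
  - by apply: eq_integral2 => x _; ring.
  - by apply: within_mul => //; exact: within_cst.
  - by apply: within_mul => //; exact: within_cst.
have -> : integral2 (hull K) (fun x => (csup K - c x) * (phi i x * phi j x)) =
    csup K * (area (hull K) / 12) - integral2 (hull K) (fun x => c x * phi j x * phi i x).
  rewrite -(phi2_integral KT iK jK ij) -(element_integralZ Hmesh Hphi _ KT cpp).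
  rewrite -[X in _ - X]mul1r -mulNr.
  rewrite -(element_integralZ Hmesh Hphi _ KT cc) -(element_integralD Hmesh Hphi KT).
  - by apply: eq_integral2 => x _; ring.
  - by apply: within_mul => //; exact: within_cst.
  - by apply: within_mul => //; exact: within_cst.
rewrite invfM invrK /be.
have -> : (2.+1%:R : R) * 2.+2%:R = 12 by rewrite -natrM.
ring.
Qed.

End Entries.

(** * Sign of the stiffness matrix *)

Section Matrix.
Variables (R : realType) (Omega : set (R * R)) (Nvi Nv : nat) (a : 'I_Nv -> R * R).
Variables (T : {set {set 'I_Nv}}) (phi : 'I_Nv -> R * R -> R).
Variables (D : R * R -> 'M[R]_2) (b : R * R -> 'cV[R]_2) (c f g : R * R -> R).
Hypothesis Hmesh : conforming_mesh Omega Nvi a T.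
Hypothesis Hphi : nodal_basis Omega a T phi.
Hypothesis Hdata : bvp_data Omega D b c f g.
Hypothesis Hangle : delaunay_type_condition Nvi a T D b c.
Implicit Types (K : {set 'I_Nv}) (x y : R * R) (i j k l : 'I_Nv).

Notation hull := (conv_hull a).
Notation grad K j := (grad_on (conv_hull a K) (phi j)).
Notation cont K h := {within conv_hull a K, continuous h}.
Notation element_entry := (element_entry a phi D b c).
Notation slack := (slack a phi b c).

Lemma Omega_open : open Omega.
Proof. by have [] := bvp_domain Hdata. Qed.

Lemma element_integral0 K (h : R * R -> R) : K \in T -> (forall x, hull K x -> h x = 0) ->
  integral2 (hull K) h = 0.
Proof.
move=> KT h0; rewrite (@eq_integral2 _ _ _ (fun=> 0 * 0)); last by move=> x /h0 ->; rewrite mul0r.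
by rewrite (element_integralZ Hmesh Hphi _ KT) ?mul0r//; exact: within_cst.
Qed.

Lemma element_entry_notin K i j : K \in T -> ~~ ((i \in K) && (j \in K)) -> element_entry K i j = 0.
Proof.
move=> KT; rewrite negb_and /element_entry => /orP[iK|jK].
  rewrite (grad_notin Hmesh Hphi KT iK) dot0l mulr0 !element_integral0 ?addr0// => x Kx;
    by rewrite (phi_notin Hphi KT Kx iK) ?mulr0 ?mul0r.
rewrite (grad_notin Hmesh Hphi KT jK) mulmx0 dot0r mulr0 !element_integral0 ?addr0// => x Kx.
  by rewrite (phi_notin Hphi KT Kx jK) mulr0 mul0r.
by rewrite dot0r mulr0.
Qed.

Definition stiffness i j : R := \sum_(K in T) element_entry K i j.

Lemma element_diffusion_cot K i j k : K \in T -> i != j -> k != i -> k != j -> K = [set i; j; k]%SET ->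
  let al := metric_angle (invmx (avg_mx (hull K) D)) (a k) (a i) (a j) in
  0 < al < pi /\
  area (hull K) * dot (grad K i) (avg_mx (hull K) D *m grad K j) =
    - (Num.sqrt (\det (avg_mx (hull K) D)) * cot al) / 2.
Proof.
move=> KT ij ki kj KE al.
have iK : i \in K by rewrite KE !inE eqxx.
have jK : j \in K by rewrite KE !inE eqxx orbT.
have kK : k \in K by rewrite KE !inE eqxx orbT.
have e0 := element_cross_neq0 Hphi KT ij ki kj KE.
have -> : area (hull K) = `|cross (a i - a k) (a j - a k)| / 2.
  by rewrite {1}(hull_triangle a ij ki kj KE) triangle_area.
apply: stiffness_cot => //; first exact: (avg_mx_posdef Hmesh Hphi Hdata).
- by rewrite (grad_vertex Hphi)// eqxx eq_sym (negPf ki) subr0.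
- by rewrite (grad_vertex Hphi)// (negPf ij) eq_sym (negPf ki) subr0.
- by rewrite (grad_vertex Hphi)// eq_sym (negPf ij) eq_sym (negPf kj) subr0.
- by rewrite (grad_vertex Hphi)// eqxx eq_sym (negPf kj) subr0.
Qed.

(** Exactly two elements contain an edge that starts at an interior vertex, one
    on each side. Their diffusion terms are cotangents, whose weighted sum is at
    least 2 * C_pair by the angle condition; what remains of the convection and
    reaction terms is minus the slacks. *)
Lemma edge_stiffness_le i j k K : (i < Nvi)%N -> K \in T -> i != j -> k != i -> k != j ->
  K = [set i; j; k]%SET ->
  exists k' K', [/\ K' \in T, k' != i, k' != j, K' = [set i; j; k']%SET &
    cross (a j - a i) (a k' - a i) * cross (a j - a i) (a k - a i) < 0] /\
    stiffness i j <= - (slack K i j + slack K' i j).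
Proof.
move=> iN KT ij ki kj KE.
have [k' [K' [K'T k'i k'j K'E sgn]]] := opposite_element Hmesh Hphi Omega_open iN KT ij ki kj KE.
exists k', K'; split=> //.
have iK : i \in K by rewrite KE !inE eqxx.
have jK : j \in K by rewrite KE !inE eqxx orbT.
have iK' : i \in K' by rewrite K'E !inE eqxx.
have jK' : j \in K' by rewrite K'E !inE eqxx orbT.
have kk' : k != k' by apply: contraTneq sgn => ->; rewrite -leNgt -expr2 sqr_ge0.
have KK' : K != K'.
  apply: contraNneq kk' => E; have : k \in K' by rewrite -E KE !inE eqxx orbT.
  by rewrite K'E !inE (negPf ki) (negPf kj).
have two : stiffness i j = element_entry K i j + element_entry K' i j.
  rewrite /stiffness (bigD1 K)//= (bigD1 K')/= ?K'T 1?eq_sym//; congr (_ + _).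
  rewrite big1 ?addr0// => L /andP[/andP[LT LK] LK'].
  apply: element_entry_notin => //; apply/negP => /andP[iL jL].
  have [l [li lj LE]] := elementP Hmesh LT iL jL ij.
  have cl0 : cross (a j - a i) (a l - a i) != 0.
    have LE' : L = [set j; l; i]%SET by rewrite LE; apply/setP => m; rewrite !inE; do 3!case: (m == _).
    by apply: (element_cross_neq0 Hphi LT _ _ _ LE') => //; rewrite eq_sym.
  set cl := cross _ _ in cl0; set ck' := cross _ (a k' - a i) in sgn.
  set ck := cross _ (a k - a i) in sgn.
  have [s1|s1] := ltP 0 (cl * ck).
    have kl := same_side_eq Hphi KT LT ij ki kj li lj KE LE s1.
    by move: LK; rewrite LE KE kl eqxx.
  have ck0 : ck != 0 by apply: contraTneq sgn => ->; rewrite mulr0 ltxx.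
  have s2 : 0 < cl * ck'.
    have cs : cl * ck < 0 by rewrite lt_def eq_sym mulf_neq0.
    rewrite -(pmulr_lgt0 _ (_ : 0 < ck ^+ 2)) ?exprn_even_gt0//.
    have -> : cl * ck' * ck ^+ 2 = (cl * ck) * (ck' * ck) by ring.
    by rewrite nmulr_lgt0.
  have kl := same_side_eq Hphi K'T LT ij k'i k'j li lj K'E LE s2.
  by move: LK'; rewrite LE K'E kl eqxx.
have [al0 sK] := element_diffusion_cot KT ij ki kj KE.
have [al'0 sK'] := element_diffusion_cot K'T ij k'i k'j K'E.
have d0 := sym_posdef_det (avg_mx_posdef Hmesh Hphi Hdata KT).
have d'0 := sym_posdef_det (avg_mx_posdef Hmesh Hphi Hdata K'T).
have := Hangle iN _ KT K'T KK' KE K'E; rewrite eq_sym => /(_ ij) /= /andP[_].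
have sqrt_div (x y : R) : 0 < x -> 0 < y -> Num.sqrt (x / y) = Num.sqrt x / Num.sqrt y.
  by move=> x0 y0; rewrite sqrtrM ?ltW// sqrtrV// ltW.
rewrite !sqrt_div// => /angle_condition.
rewrite !sqrtr_gt0 => /(_ d0 d'0 al0 al'0).
rewrite two !(element_entryE Hmesh Hphi Hdata)// sK sK' /C_pair; lra.
Qed.

Lemma stiffness_offdiag_le0 i j : (i < Nvi)%N -> i != j -> stiffness i j <= 0.
Proof.
move=> iN ij; have [/existsP[K /and3P[KT iK jK]]|] := boolP [exists K, [&& K \in T, i \in K & j \in K]].
  have [k [ki kj KE]] := elementP Hmesh KT iK jK ij.
  have [k' [K' [[K'T _ _ _ _] le]]] := edge_stiffness_le iN KT ij ki kj KE.
  rewrite (le_trans le)// oppr_le0 addr_ge0//; exact: (slack_ge0 Hmesh Hphi Hdata).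
rewrite negb_exists => /forallP none; rewrite /stiffness big1// => K KT.
by apply: element_entry_notin => //; have := none K; rewrite KT.
Qed.

(** The nodal functions add up to 1 and their gradients to 0, so only the
    reaction term survives. *)
Lemma stiffness_row_sum i :
  \sum_j stiffness i j = \sum_(K in T) integral2 (hull K) (fun x => c x * phi i x).
Proof.
rewrite /stiffness exchange_big /=; apply: eq_bigr => K KT.
have cp l : cont K (phi l) by exact: (within_phi Hmesh Hphi).
have cc : cont K c by exact: (within_c Hmesh Hdata).
rewrite /element_entry !big_split /= -mulr_sumr -dot_sumr -mulmx_sumr (grad_sum Hmesh Hphi KT).
rewrite mulmx0 dot0r mulr0 add0r -!(element_integral_sum Hmesh Hphi KT).
- rewrite element_integral0// ?add0r => [|x Kx]; last first.
    by rewrite -mulr_sumr -dot_sumr (grad_sum Hmesh Hphi KT) dot0r mulr0.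
  apply: eq_integral2 => x Kx.
  by rewrite -mulr_suml -mulr_sumr (phi_sum Hphi KT Kx) mulr1.
- by move=> j; apply: within_mul => //; apply: within_mul.
- by move=> j; apply: within_mul => //; exact: (within_dot_b Hmesh Hdata).
Qed.

Lemma U0h_phi i : (i < Nvi)%N -> U0h Nvi phi (phi i).
Proof.
move=> iN; exists (fun j => (j == i)%:R); apply/funext => x.
rewrite (bigD1 i)//= eqxx mul1r big1 ?addr0// => j /andP[_ /negPf ->]; exact: mul0r.
Qed.

Lemma row_equation (u : 'I_Nv -> R) i : (i < Nvi)%N ->
  (forall v, U0h Nvi phi v ->
        \sum_(K in T) area (conv_hull a K) *
          dot (grad_on (conv_hull a K) v)
              (avg_mx (conv_hull a K) D *m grad_on (conv_hull a K) (fun x => \sum_j u j * phi j x))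
      + \sum_(K in T) integral2 (conv_hull a K)
          (fun x => v x * dot (b x) (grad_on (conv_hull a K) (fun x => \sum_j u j * phi j x)))
      + \sum_(K in T) integral2 (conv_hull a K) (fun x => c x * (\sum_j u j * phi j x) * v x)
      = \sum_(K in T) integral2 (conv_hull a K) (fun x => f x * v x)) ->
  \sum_j u j * stiffness i j = \sum_(K in T) integral2 (hull K) (fun x => f x * phi i x).
Proof.
move=> iN /(_ _ (U0h_phi iN)) <-.
under eq_bigr do rewrite /stiffness mulr_sumr.
rewrite exchange_big -!big_split /=; apply: eq_bigr => K KT.
have cp l : cont K (phi l) by exact: (within_phi Hmesh Hphi).
have cc : cont K c by exact: (within_c Hmesh Hdata).
have cst (r : R) : cont K (fun=> r) by exact: within_cst.
have cb l : cont K (fun x => phi i x * dot (b x) (grad K l)).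
  by apply: within_mul => //; exact: (within_dot_b Hmesh Hdata).
have ccc l : cont K (fun x => c x * phi l x * phi i x) by apply: within_mul => //; apply: within_mul.
rewrite (grad_fe Hmesh Hphi u xpredT KT) mulmx_sumr dot_sumr mulr_sumr.
rewrite (@eq_integral2 _ _ (fun x => phi i x * dot (b x) _)
  (fun x => \sum_j u j * (phi i x * dot (b x) (grad K j)))); last first.
  move=> x _; rewrite dot_sumr mulr_sumr; apply: eq_bigr => j _; rewrite dotZr; ring.
rewrite [X in _ = _ + _ + X](@eq_integral2 _ _ _
  (fun x => \sum_j u j * (c x * phi j x * phi i x))); last first.
  move=> x _; rewrite mulr_sumr mulr_suml; apply: eq_bigr => j _; ring.
rewrite !(element_integral_sum Hmesh Hphi KT); [|by move=> j; apply: within_mul..].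
rewrite -!big_split /=; apply: eq_bigr => j _.
rewrite !(element_integralZ Hmesh Hphi _ KT)// /element_entry -scalemxAr dotZr; ring.
Qed.

End Matrix.

(** * The set where the discrete solution is maximal *)

Section MaximumPrinciple.
Variables (R : realType) (Omega : set (R * R)) (Nvi Nv : nat) (a : 'I_Nv -> R * R).
Variables (T : {set {set 'I_Nv}}) (phi : 'I_Nv -> R * R -> R).
Variables (D : R * R -> 'M[R]_2) (b : R * R -> 'cV[R]_2) (c f g : R * R -> R).
Hypothesis Hmesh : conforming_mesh Omega Nvi a T.
Hypothesis Hphi : nodal_basis Omega a T phi.
Hypothesis Hdata : bvp_data Omega D b c f g.
Hypothesis Hangle : delaunay_type_condition Nvi a T D b c.
Implicit Types (K : {set 'I_Nv}) (x y : R * R) (i j k l : 'I_Nv) (S : {set 'I_Nv}).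

Notation hull := (conv_hull a).
Notation grad K j := (grad_on (conv_hull a K) (phi j)).
Notation cont K h := {within conv_hull a K, continuous h}.
Notation element_entry := (element_entry a phi D b c).
Notation slack := (slack a phi b c).
Notation stiffness := (stiffness a T phi D b c).
Notation bsup K := (bsup a b K).

Lemma closure_c_ge0 K x : K \in T -> hull K x -> 0 <= c x.
Proof.
move=> KT Kx; have Ox := hull_sub Hmesh KT Kx; move: x Ox {Kx}.
exact: (closure_ge0 (bvp_c_smooth Hdata) (bvp_c_ge0 Hdata)).
Qed.

(** The hypotheses on S hold for the set of vertices where a solution with
    nonpositive right-hand side takes a positive value that is maximal and is not
    attained on the boundary. They turn out to be contradictory unless S is empty. *)
Section Level.
Variable S : {set 'I_Nv}.
Hypothesis level_interior : forall i, i \in S -> (i < Nvi)%N.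
Hypothesis level_stiffness : forall i j, i \in S -> j \notin S -> stiffness i j = 0.
Hypothesis level_reaction : forall i K, i \in S -> K \in T ->
  integral2 (hull K) (fun x => c x * phi i x) = 0.

Lemma level_neq i j : i \in S -> j \notin S -> i != j.
Proof. by move=> iS; apply: contraNneq => <-. Qed.

Lemma level_slack_eq0 K i j : K \in T -> i \in K -> j \in K -> i \in S -> j \notin S -> slack K i j = 0.
Proof.
move=> KT iK jK iS jS; have ij := level_neq iS jS.
have [k [ki kj KE]] := elementP Hmesh KT iK jK ij.
have [k' [K' [[K'T _ _ _ _]]]] :=
  edge_stiffness_le Hmesh Hphi Hdata Hangle (level_interior iS) KT ij ki kj KE.
rewrite (level_stiffness iS jS) => h.
have := slack_ge0 Hmesh Hphi Hdata i j KT; have := slack_ge0 Hmesh Hphi Hdata i j K'T; lra.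
Qed.

(** Vanishing slack is the equality case of Cauchy-Schwarz for b and the
    gradient of phi j. *)
Lemma level_field K i j x : K \in T -> i \in K -> j \in K -> i \in S -> j \notin S ->
  hull K x -> 0 < phi i x -> b x = (bsup K / enorm (grad K j)) *: grad K j.
Proof.
move=> KT iK jK iS jS Kx px; have ij := level_neq iS jS.
apply: cauchy_schwarz_eq; first exact: (grad_neq0 Hphi KT iK jK ij).
  exact: (b_le_bsup Hmesh Hphi Hdata KT Kx).
exact: (slack_eq0 Hmesh Hphi Hdata KT (level_slack_eq0 KT iK jK iS jS) Kx px).
Qed.

(** The slack says nothing at a j, where phi i vanishes; the value there is the
    limit along the edge from a j to a i. *)
Lemma level_field_outer K i j : K \in T -> i \in K -> j \in K -> i \in S -> j \notin S ->
  b (a j) = (bsup K / enorm (grad K j)) *: grad K j.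
Proof.
move=> KT iK jK iS jS; have ij := level_neq iS jS.
apply: cauchy_schwarz_eq; first exact: (grad_neq0 Hphi KT iK jK ij).
  by apply: (b_le_bsup Hmesh Hphi Hdata KT); exact: vertex_in_hull.
set be := bsup K * _; set q := grad K j.
pose h x := be - dot (b x) q.
have ch : cont K h by apply: within_sub; [exact: within_cst|exact: (within_dot_b Hmesh Hdata)].
have Kj := vertex_in_hull a jK; have Ki := vertex_in_hull a iK.
apply/eqP; rewrite eq_sym -subr_eq0 -/(h (a j)) eq_le; apply/andP; split; last first.
  by rewrite subr_ge0 (bdot_le Hmesh Hphi Hdata).
rewrite leNgt; apply/negP => hj.
have cj : h @ within (hull K) (nbhs (a j)) --> h (a j).
  by move: ch => /subspace_continuousP; apply.
have : \forall y \near within (hull K) (nbhs (a j)), `|h (a j) - h y| < h (a j).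
  by move/cvgrPdist_lt : cj; apply.
rewrite near_withinE => /nbhs_ballP[d /= d0 dh].
have [s /andP[s0 s1] /dh] := @ball_step _ (a j) (a i - a j) d d0.
have Ky : hull K (a j + s *: (a i - a j)) by apply: hull_segment; rewrite ?(ltW s0) ?(ltW s1).
move=> /(_ Ky).
have py : 0 < phi i (a j + s *: (a i - a j)).
  rewrite (phi_shift Hphi i KT Kj Ky) (phi_vertex Hphi) (negPf ij).
  rewrite (_ : _ - a j = s *: (a i - a j)); last by rewrite addrC addKr.
  by rewrite vecZ dotZr (grad_vertex Hphi)// eqxx (negPf ij) subr0 add0r mulr1.
rewrite {2}/h (slack_eq0 Hmesh Hphi Hdata KT (level_slack_eq0 KT iK jK iS jS) Ky py) subrr subr0.
by rewrite gtr0_norm// ltxx.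
Qed.

(** If k were outside S as well, then b (a i) would be a positive multiple of
    the gradients of phi j and of phi k, which are independent. *)
Lemma level_third_vertex K i j k : K \in T -> i \in K -> j \in K -> k \in K -> i \in S -> j \notin S ->
  k != j -> 0 < bsup K -> k \in S.
Proof.
move=> KT iK jK kK iS jS kj B0; apply: contraT => kS.
have ij := level_neq iS jS; have ik := level_neq iS kS.
have Ki := vertex_in_hull a iK.
have pi : 0 < phi i (a i) by rewrite (phi_vertex Hphi) eqxx.
have := level_field KT iK jK iS jS Ki pi; rewrite (level_field KT iK kK iS kS Ki pi).
move=> /(congr1 (fun q => dot q (vec (a j - a i)))); rewrite !dotZl.
rewrite !(grad_vertex Hphi)// eqxx (negPf kj) (eq_sym k) (negPf ik) (eq_sym j) (negPf ij) !subr0.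
rewrite mulr0 mulr1 => /esym/eqP; rewrite mulf_eq0 (gt_eqF B0) invr_eq0 enorm_eq0 /=.
by rewrite (negPf (grad_neq0 Hphi KT iK jK ij)).
Qed.

Lemma bsup_ge0 K i : K \in T -> i \in K -> 0 <= bsup K.
Proof.
move=> KT iK; have := b_le_bsup Hmesh Hphi Hdata KT (vertex_in_hull a iK).
by apply: le_trans; exact: enorm_ge0.
Qed.

(** Suppose that b does not vanish at a j. On all elements that contain j and a
    vertex of S, the gradient of phi j has the direction of b (a j); hence the
    neighbours of j in S lie in an open half-plane bounded by a line through a
    j. Consider the extreme one in the angular order around a j. The edge from
    it to j is shared by two elements on opposite sides, whose third vertices
    are again neighbours of j in S, and one of these is more extreme. *)
Lemma level_field_eq0 K0 i j : K0 \in T -> i \in K0 -> j \in K0 -> i \in S -> j \notin S -> bsup K0 = 0.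
Proof.
move=> K0T i0K j0K i0S jS; apply/eqP; apply: contraT => B0.
set v := b (a j).
have v0 : v != 0.
  rewrite /v (level_field_outer K0T i0K j0K i0S jS) scaler_eq0 negb_or
    mulf_neq0 ?invr_eq0 ?enorm_eq0 ?invr_neq0//;
    rewrite ?enorm_eq0 (grad_neq0 Hphi K0T i0K j0K)//; exact: level_neq.
(* All these elements see the same nonzero vector v, so bsup is positive on each. *)
have pos K l : K \in T -> l \in K -> j \in K -> l \in S ->
    0 < bsup K /\ 0 < dot v (vec (a j - a l)).
  move=> KT lK jK lS; have lj := level_neq lS jS; have vE := level_field_outer KT lK jK lS jS.
  have B_gt0 : 0 < bsup K.
    rewrite lt_def (bsup_ge0 KT lK) andbT; apply: contraNneq v0 => B00.
    by rewrite /v vE B00 mul0r scale0r.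
  split=> //; rewrite /v vE dotZl (grad_vertex Hphi)// eqxx eq_sym (negPf lj) subr0 mulr1.
  by rewrite divr_gt0// lt_def enorm_eq0 enorm_ge0 (grad_neq0 Hphi KT lK jK lj).
(* In the half-plane, r is monotone in the angle around a j. *)
pose Z := [pred l | (l \in S) && [exists K, [&& K \in T, l \in K & j \in K]]].
pose r l := (v 0 0 * (a l - a j).2 - v 1 0 * (a l - a j).1) / dot v (vec (a j - a l)).
have Zi : Z i by rewrite /= i0S; apply/existsP; exists K0; rewrite K0T i0K.
have [l /andP[lS /existsP[L /and3P[LT lL jL]]] rmax] := @arg_maxP _ _ _ i Z r Zi.
have lj := level_neq lS jS.
have [k [kl kj LE]] := elementP Hmesh LT lL jL lj.
have kL : k \in L by rewrite LE !inE eqxx orbT.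
have [k' [L' [[L'T k'l k'j L'E sgn] _]]] :=
  edge_stiffness_le Hmesh Hphi Hdata Hangle (level_interior lS) LT lj kl kj LE.
have lL' : l \in L' by rewrite L'E !inE eqxx.
have jL' : j \in L' by rewrite L'E !inE eqxx orbT.
have k'L' : k' \in L' by rewrite L'E !inE eqxx orbT.
have [BL pl] := pos _ _ LT lL jL lS.
have [BL' _] := pos _ _ L'T lL' jL' lS.
have kS := level_third_vertex LT lL jL kL lS jS kj BL.
have k'S := level_third_vertex L'T lL' jL' k'L' lS jS k'j BL'.
have [_ pk] := pos _ _ LT kL jL kS; have [_ pk'] := pos _ _ L'T k'L' jL' k'S.
have rk : r k <= r l by apply: rmax; rewrite /= kS; apply/existsP; exists L; rewrite LT kL.
have rk' : r k' <= r l by apply: rmax; rewrite /= k'S; apply/existsP; exists L'; rewrite L'T k'L'.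
have vv : 0 < dot v v by rewrite -enorm_sqr exprn_gt0// lt_def enorm_eq0 v0 enorm_ge0.
(* Neighbours that are less extreme than l lie on one side of the edge. *)
have key m : 0 < dot v (vec (a j - a m)) -> r m <= r l ->
    cross (a j - a l) (a m - a l) <= 0.
  move=> pm; rewrite /r ler_pdivrMr// mulrAC ler_pdivlMr// => h.
  rewrite -(pmulr_rle0 _ vv).
  rewrite (_ : _ * cross _ _ = (v 0 0 * (a m - a j).2 - v 1 0 * (a m - a j).1) * dot v (vec (a j - a l))
    - (v 0 0 * (a l - a j).2 - v 1 0 * (a l - a j).1) * dot v (vec (a j - a m))).
    by rewrite subr_le0.
  by rewrite dotE !dot_vec /cross /=; ring.
by move: sgn; rewrite ltNge mulr_le0 ?key.
Qed.

(** Only diffusion is left on the elements that meet both S and its complement.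
    The sum of the stiffness entries over S and its complement is then minus the
    diffusion energy of the sum of the phi l over S. It vanishes, whereas this
    sum is not constant on an element that has vertices in both sets. *)
Lemma level_neighbor_closed K0 i j : K0 \in T -> i \in K0 -> j \in K0 -> i \in S -> j \in S.
Proof.
move=> K0T i0K j0K i0S; apply: contraT => j0S.
have entE K i' j' : K \in T -> i' \in K -> j' \in K -> i' \in S -> j' \notin S ->
    element_entry K i' j' = area (hull K) * dot (grad K i') (avg_mx (hull K) D *m grad K j').
  move=> KT iK jK iS jS; rewrite /element_entry.
  rewrite (element_integral0 Hmesh Hphi KT) ?(element_integral0 Hmesh Hphi KT) ?addr0// => x Kx.
    have cx : c x * phi i' x = 0.
      apply: (element_integral_eq0 Hmesh Hphi KT _ _ (level_reaction iS KT)) Kx.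
        by apply: within_mul; [exact: (within_c Hmesh Hdata)|exact: (within_phi Hmesh Hphi)].
      by move=> y Ky; rewrite mulr_ge0 ?(closure_c_ge0 KT)// (phi_ge0 Hphi i' KT Ky).
    by rewrite mulrAC cx mul0r.
  have : enorm (b x) <= 0.
    by rewrite -(level_field_eq0 KT iK jK iS jS); exact: (b_le_bsup Hmesh Hphi Hdata).
  move=> b0; have /eqP : enorm (b x) = 0 by apply: le_anti; rewrite b0 enorm_ge0.
  by rewrite enorm_eq0 => /eqP ->; rewrite dot0l mulr0.
pose w K := \sum_(l in S) grad K l.
have DK K : K \in T -> 0 <= area (hull K) * dot (w K) (avg_mx (hull K) D *m w K).
  move=> KT; rewrite mulr_ge0 ?(ltW (area_gt0 Hmesh Hphi KT))//.
  have [->|w0] := eqVneq (w K) 0; first by rewrite dot0l.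
  by apply: ltW; exact: (avg_mx_posdef Hmesh Hphi Hdata KT).2.
have sumK K : K \in T -> \sum_(l in S) \sum_(m | m \notin S) element_entry K l m =
    - (area (hull K) * dot (w K) (avg_mx (hull K) D *m w K)).
  move=> KT.
  have wE : w K = - \sum_(m | m \notin S) grad K m.
    apply/eqP; rewrite -addr_eq0; apply/eqP.
    by rewrite -[RHS](grad_sum Hmesh Hphi KT) [RHS](bigID (mem S)).
  have -> : avg_mx (hull K) D *m w K =
      (-1) *: (avg_mx (hull K) D *m (\sum_(m | m \notin S) grad K m)).
    by rewrite wE mulmxN scaleN1r.
  rewrite dotZr mulN1r mulrN opprK.
  rewrite mulmx_sumr dot_sumr mulr_sumr.
  rewrite exchange_big /=; apply: eq_bigr => m mS.
  rewrite dot_suml mulr_sumr; apply: eq_bigr => l lS.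
  have [lK|lK] := boolP (l \in K); last first.
    by rewrite (element_entry_notin D b c Hmesh Hphi)// ?(negPf lK)//
      (grad_notin Hmesh Hphi KT lK) dot0l mulr0.
  have [mK|mK] := boolP (m \in K); last first.
    by rewrite (element_entry_notin D b c Hmesh Hphi)// ?(negPf mK) ?andbF//
      (grad_notin Hmesh Hphi KT mK) mulmx0 dot0r mulr0.
  exact: entE.
have : \sum_(l in S) \sum_(m | m \notin S) stiffness l m = 0.
  by rewrite big1// => l lS; rewrite big1// => m mS; exact: level_stiffness.
under eq_bigr do rewrite exchange_big /=.
rewrite exchange_big /= (eq_bigr _ sumK) sumrN => /eqP; rewrite oppr_eq0.
rewrite psumr_eq0 => [/allP/(_ K0)|K' K'T]; last exact: DK.
rewrite mem_index_enum K0T /= => /(_ isT).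
rewrite mulf_eq0 gt_eqF ?(area_gt0 Hmesh Hphi)//= gt_eqF//.
apply: (avg_mx_posdef Hmesh Hphi Hdata K0T).2.
apply: contraTneq isT => w0; have : dot (w K0) (vec (a i - a j)) = 1.
  rewrite dot_suml (bigD1 i)//= (grad_vertex Hphi)// eqxx (negPf (level_neq i0S j0S)) subr0.
  rewrite big1 ?addr0// => l /andP[lS li]; rewrite (grad_vertex Hphi)// (negPf li).
  by rewrite (negPf (level_neq lS j0S)) subr0.
by rewrite w0 dot0l => /eqP; rewrite eq_sym oner_eq0.
Qed.

(** A rightmost vertex of S is interior, so that some element around it reaches
    further to the right; but all vertices of this element are in S. *)
Lemma level_empty : S = finset.set0.
Proof.
apply/eqP; apply: contraT => /set0Pn[i0 i0S].
have [i iS imax] := @arg_maxP _ _ _ i0 (mem S) (fun l => (a l).1) i0S.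
have Oi := interior_vertex_Omega Hmesh (level_interior iS).
have [d d0 near_i] := near_element Hmesh (Omega_open Hdata) Oi.
have [s /andP[s0 s1] /near_i[K [KT Ki Ky]]] := @ball_step _ (a i) (1, 0) d d0.
have iK : i \in K.
  by apply: (phi_pos_in Hphi KT Ki); rewrite (phi_vertex Hphi) eqxx.
set y := a i + s *: (1, 0) in Ky.
have : y.1 <= (a i).1.
  rewrite {1}(phi_comb Hphi KT Ky) (_ : _.1 = \sum_(l in K) phi l y * (a l).1).
    rewrite -[leRHS]mul1r -(phi_sum_in Hphi KT Ky) mulr_suml; apply: ler_sum => l lK.
    rewrite ler_wpM2l ?(phi_ge0 Hphi l KT Ky)//.
    by apply: imax; exact: (level_neighbor_closed KT iK lK iS).
  by rewrite (big_morph fst (id1 := 0) (op1 := +%R)).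
by rewrite /y /= /GRing.scale /= mulr1 gerDl leNgt s0.
Qed.

End Level.
End MaximumPrinciple.

(** * The discrete maximum principle *)

Theorem theorem4p2 (R : realType) (Omega : set (R * R))
    (D : R * R -> 'M[R]_2) (b : R * R -> 'cV[R]_2) (c f g : R * R -> R)
    (Nvi Nv : nat) (a : 'I_Nv -> R * R) (T : {set {set 'I_Nv}})
    (phi : 'I_Nv -> R * R -> R)
    (Hdata : bvp_data Omega D b c f g)
    (Hmesh : conforming_mesh Omega Nvi a T)
    (Hphi : nodal_basis Omega a T phi)
    (Hangle : delaunay_type_condition Nvi a T D b c) :
  satisfies_DMP Omega Nvi a T phi D b c f g.
Proof.
move=> uh [u [uhE _ row]] f0; rewrite uhE in row *.
have mem_cover x : closure Omega x -> exists2 K, K \in T & conv_hull a K x.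
  by rewrite (mesh_cover Hmesh) => -[K KT Kx]; exists K.
have vertex l : \sum_j u j * phi j (a l) = u l.
  rewrite (bigD1 l)//= (phi_vertex Hphi) eqxx mulr1 big1 ?addr0// => j /negPf jl.
  by rewrite (phi_vertex Hphi) jl mulr0.
have uh_le B x : (forall l, u l <= B) -> closure Omega x -> \sum_j u j * phi j x <= B.
  move=> uB /mem_cover[K KT Kx]; rewrite -[B]mulr1 -(phi_sum Hphi KT Kx) mulr_sumr.
  by apply: ler_sum => j _; rewrite ler_wpM2r// (phi_ge0 Hphi j KT Kx).
set bd := [set _ | _ in boundary Omega]; set G := Num.max 0 (sup bd).
have [_ _ [x0 Ox0] _ _] := bvp_domain Hdata.
suff uG l : u l <= G.
  apply: ge_sup; first by exists (\sum_j u j * phi j x0); exists x0 => //; exact: subset_closure.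
  by move=> _ [x Ox <-]; exact: uh_le.
rewrite leNgt; apply/negP => Gl.
have [i _ imax] := @arg_maxP _ _ _ l xpredT u isT.
have Gi : G < u i by apply: lt_le_trans Gl (imax l isT).
have M0 : 0 < u i by apply: le_lt_trans Gi; rewrite le_max lexx.
have bdG : sup bd <= G by rewrite le_max lexx orbT.
pose S := [set j | u j == u i]%SET.
have level_interior j : j \in S -> (j < Nvi)%N.
  rewrite inE => /eqP uj; apply: contraT => jN.
  have bj : boundary Omega (a j).
    by apply: contrapT => /(mesh_interior_first Hmesh j).2; apply/negP.
  have : u j <= sup bd.
    apply: ub_le_sup; last by exists (a j).
    exists (u i) => _ [x [Ox _] <-]; apply: uh_le => // l'; exact: imax.
  by rewrite uj => /le_trans/(_ bdG); rewrite leNgt Gi.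
have f_le0 K x : K \in T -> conv_hull a K x -> f x <= 0.
  move=> KT Kx; rewrite -oppr_ge0; have Ox := hull_sub Hmesh KT Kx; move: x Ox {Kx}.
  apply: closure_ge0 => [x|x Ox]; last by rewrite oppr_ge0 f0.
  by apply: cvgN; exact: (bvp_f_smooth Hdata).
have row_S j : j \in S -> (forall k, k \notin S -> stiffness a T phi D b c j k = 0) /\
    forall K, K \in T -> integral2 (conv_hull a K) (fun x => c x * phi j x) = 0.
  move=> jS; have jN := level_interior j jS; have uj : u j = u i by move: jS; rewrite inE => /eqP.
  have cphi K x : K \in T -> conv_hull a K x -> 0 <= c x * phi j x.
    by move=> KT Kx; rewrite mulr_ge0 ?(closure_c_ge0 Hmesh Hdata KT Kx)// (phi_ge0 Hphi j KT Kx).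
  have I0 K : K \in T -> 0 <= integral2 (conv_hull a K) (fun x => c x * phi j x).
    by move=> KT; apply: integral2_ge0 => x; exact: cphi.
  have := row_equation Hmesh Hphi Hdata jN row; have := stiffness_row_sum Hmesh Hphi Hdata j.
  set rhs := \sum_(K in T) integral2 _ (fun x => f x * _).
  have rhs0 : rhs <= 0.
    apply: sumr_le0 => K KT.
    have cf : {within conv_hull a K, continuous f}.
      by apply: (within_hull Hmesh KT); exact: (bvp_f_smooth Hdata).
    rewrite -oppr_ge0 -mulN1r -(element_integralZ Hmesh Hphi _ KT).
      apply: integral2_ge0 => x Kx; rewrite mulN1r oppr_ge0 mulr_le0_ge0 ?(f_le0 K)//.
      exact: (phi_ge0 Hphi j KT Kx).
    by apply: within_mul => //; exact: (within_phi Hmesh Hphi).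
  set I := \sum_(K in T) _ => sumE rowE.
  have I_ge0 : 0 <= I by apply: sumr_ge0.
  have dge0 k : 0 <= (u k - u i) * stiffness a T phi D b c j k.
    have [->|kj] := eqVneq k j; first by rewrite uj subrr mul0r.
    apply: mulr_le0; first by rewrite subr_le0; exact: imax.
    by apply: (stiffness_offdiag_le0 Hmesh Hphi Hdata Hangle) => //; rewrite eq_sym.
  (* Around the value u i, the row equation equates a sum of two nonnegative terms
     with a nonpositive right-hand side. *)
  have split : \sum_k u k * stiffness a T phi D b c j k =
      u i * I + \sum_k (u k - u i) * stiffness a T phi D b c j k.
    rewrite -sumE mulr_sumr -big_split; apply: eq_bigr => k _ /=; ring.
  have s0 : 0 <= \sum_k (u k - u i) * stiffness a T phi D b c j k by exact: sumr_ge0.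
  have m0 : 0 <= u i * I by rewrite mulr_ge0// ltW.
  have sE : \sum_k (u k - u i) * stiffness a T phi D b c j k = 0.
    by apply: le_anti; rewrite s0 andbT; move: rowE rhs0; rewrite split; lra.
  have mE : u i * I = 0.
    by apply: le_anti; rewrite m0 andbT; move: rowE rhs0; rewrite split; lra.
  split=> [k kS|K KT].
    move/eqP: sE; rewrite psumr_eq0// => /allP/(_ k); rewrite mem_index_enum => /(_ isT).
    by rewrite mulf_eq0 subr_eq0; move: kS; rewrite inE => /negPf -> /eqP.
  move/eqP: mE; rewrite mulf_eq0 (gt_eqF M0) /= psumr_eq0// => /allP/(_ K).
  by rewrite mem_index_enum KT => /(_ isT)/eqP.
have : S = finset.set0.
  apply: (level_empty Hmesh Hphi Hdata Hangle level_interior) => [j k jS|j K jS].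
    exact: (row_S j jS).1.
  exact: (row_S j jS).2.
by move/setP/(_ i); rewrite !inE eqxx.
Qed.
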